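(* Let $\Gamma$ be a regular inhomogeneous $Y$-semigroup and $(s,t) \in \Delta_J$. Assume that $A_\Gamma(u) \in \mathcal{B}(Y_1,Y)$ for all $u \in J$ and that $u \mapsto \|A_\Gamma(u)\|_{\mathcal{B}(Y_1,Y)}$ belongs to $L^1([s,t])$. Then for $f \in \mathcal{D}(A_\Gamma \in Y_1)$: \[ \Gamma(s,t)f=f+\int_s^tA_\Gamma(u)f\, du+\int_s^t \int_s^u \Gamma(s,r) A_\Gamma(r) A_\Gamma(u)f\, dr\, du . \] Assume in addition that (i) $A_\Gamma$ is $Y_1$-strongly continuous, and (ii) the maps $u \mapsto \Gamma(s,u) A_\Gamma^2(u)f$ and $u \mapsto \int_s^u \Gamma(s,r) A_\Gamma(r) A'_\Gamma(u)f\,dr$ are Bochner integrable on $[s,t]$. Then for $f \in \mathcal{D}(A_\Gamma')$: \[ \Gamma(s,t)f=f+\int_s^tA_\Gamma(u)f\, du+\int_s^t (t-u) \Gamma(s,u) A_\Gamma^2(u)f\,du+\int_s^t (t-u) \int_s^u \Gamma(s,r) A_\Gamma(r) A'_\Gamma(u)f\,dr\,du . \]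
   Context: Let $(Y,\|\cdot\|)$ be a real separable Banach space and $(Y_1,\|\cdot\|_{Y_1})$ a real separable Banach space continuously embedded in $Y$. $J$ is either $\mathbb{R}^+$ or $[0,T_\infty]$ ($T_\infty>0$), $\Delta_J=\{(s,t)\in J^2:s\le t\}$, $J(s)=\{t\in J:t\ge s\}$. An inhomogeneous $Y$-semigroup is a map $\Gamma:\Delta_J\to\mathcal B(Y)$ with $\Gamma(t,t)=I$ and $\Gamma(s,r)\Gamma(r,t)=\Gamma(s,t)$ for $s\le r\le t$. Generator: for $t\in J$, $\mathcal D(A_\Gamma(t))$ is the set of $f\in Y$ such that $\lim_{h\downarrow0,\,t+h\in J}h^{-1}(\Gamma(t,t+h)-I)f$ and $\lim_{h\downarrow0,\,t-h\in J}h^{-1}(\Gamma(t-h,t)-I)f$ exist in $Y$ and are equal, $A_\Gamma(t)f$ being the common value; $\mathcal D(A_\Gamma)=\bigcap_t\mathcal D(A_\Gamma(t))$. $\Gamma$ is regular if: $Y_1\subseteq\mathcal D(A_\Gamma)$; $\Gamma(s,t)Y_1\subseteq Y_1$ for all $(s,t)\in\Delta_J$ and for every $f\in Y_1$, $t\in J$, $u\mapsto\Gamma(u,t)f$ is $\|\cdot\|_{Y_1}$-continuous on $\{u\in J:u\le t\}$; for every $f\in Y$, $s\in J$, $u\mapsto\Gamma(s,u)f$ is continuous from $J(s)$ into $Y$; and for all $(s,t)\in\Delta_J$, $f\in Y_1$, $u\mapsto\Gamma(s,u)A_\Gamma(u)f$ is Bochner integrable on $[s,t]$. Define $\mathcal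 D(A_\Gamma\in Y_1)=\{f\in\mathcal D(A_\Gamma)\cap Y_1: A_\Gamma(t)f\in Y_1\ \forall t\in J\}$ and $\mathcal D(A'_\Gamma)$ the set of $f\in\mathcal D(A_\Gamma\in Y_1)$ such that for all $t\in J$ the limit $A'_\Gamma(t)f:=\lim_{h\to0,\,t+h\in J}h^{-1}(A_\Gamma(t+h)f-A_\Gamma(t)f)$ exists in the $\|\cdot\|_{Y_1}$-norm and lies in $Y_1$. $A_\Gamma$ is $Y_1$-strongly continuous means that $t\mapsto A_\Gamma(t)f$ is continuous from $J$ into $Y$ for every $f\in Y_1$; $A^2_\Gamma(u)=A_\Gamma(u)A_\Gamma(u)$. *)

(* Defs.v *)
From HB Require Import structures.
From mathcomp Require Import all_boot all_order all_algebra.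
From mathcomp Require Import all_classical all_reals all_analysis.
Set Implicit Arguments. Unset Strict Implicit. Unset Printing Implicit Defensive.
Import Order.TTheory GRing.Theory Num.Theory.
Import numFieldNormedType.Exports.
Local Open Scope classical_set_scope.
Local Open Scope ring_scope.

Section Defs.
Context {R : realType}.

Definition separable (V : normedModType R) : Prop :=
  exists D : set V, countable D /\ closure D = setT.

Definition bounded_op (U V : normedModType R) (T : U -> V) : Prop :=
  linear T /\ exists C : R, forall x, `|T x| <= C * `|x|.

Definition opnorm (U V : normedModType R) (T : U -> V) : R :=
  sup [set `|T x| | x in [set x : U | `|x| <= 1]].

Definition cont_embedding (Y1 Y : normedModType R) (iota : Y1 -> Y) : Prop :=
  bounded_op iota /\ injective iota.

Definition time_domain (J : set R) : Prop :=
  J = `[0, +oo[%classic \/ exists T : R, 0 < T /\ J = `[0, T]%classic.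

Definition inhom_semigroup (Y : normedModType R) (J : set R)
    (Gam : R -> R -> Y -> Y) : Prop :=
  (forall s t, J s -> J t -> s <= t -> bounded_op (Gam s t)) /\
  (forall t, J t -> forall f, Gam t t f = f) /\
  (forall s r t, J s -> J r -> J t -> s <= r -> r <= t ->
     forall f, Gam s r (Gam r t f) = Gam s t f).

(** right / left difference quotients make sense near t (h small, t +- h in J) *)
Definition right_ok (J : set R) (t : R) : Prop :=
  \forall h \near 0^'+, J (t + h).
Definition left_ok (J : set R) (t : R) : Prop :=
  \forall h \near 0^'+, J (t - h).

Definition is_gen (Y : normedModType R) (J : set R) (Gam : R -> R -> Y -> Y)
    (t : R) (f g : Y) : Prop :=
  (right_ok J t \/ left_ok J t) /\
  (right_ok J t ->
     (fun h => h^-1 *: (Gam t (t + h) f - f))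
       @ within [set h | J (t + h)] 0^'+ --> g) /\
  (left_ok J t ->
     (fun h => h^-1 *: (Gam (t - h) t f - f))
       @ within [set h | J (t - h)] 0^'+ --> g).

Definition in_dom_gen (Y : normedModType R) J Gam (t : R) (f : Y) : Prop :=
  exists g, @is_gen Y J Gam t f g.

Definition in_dom_genJ (Y : normedModType R) J Gam (f : Y) : Prop :=
  forall t, J t -> @in_dom_gen Y J Gam t f.

Definition Agen (Y : normedModType R) J Gam (t : R) (f : Y) : Y :=
  xget 0 [set g | @is_gen Y J Gam t f g].

(** the (unique) Y1-preimage under iota (0 if none) *)
Definition preim (Y1 Y : normedModType R) (iota : Y1 -> Y) (y : Y) : Y1 :=
  xget 0 [set x | iota x = y].

Notation leb := (@completed_lebesgue_measure R).

(** a simple function is given by a finite list of (set, vector) pairs *)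
Definition simple_ok (Y : normedModType R) (l : seq (set R * Y)) : Prop :=
  forall p, p \in l -> measurable (p.1 : set _) /\ (leb p.1 < +oo)%E.

Definition simple_eval (Y : normedModType R) (l : seq (set R * Y)) (x : R) : Y :=
  \sum_(p <- l) (\1_(p.1) x : R) *: p.2.

Definition simple_int (Y : normedModType R) (D : set R) (l : seq (set R * Y)) : Y :=
  \sum_(p <- l) fine (leb (p.1 `&` D)) *: p.2.

Definition bochner_approx (Y : normedModType R) (D : set R) (f : R -> Y)
    (sn : nat -> seq (set R * Y)) : Prop :=
  (forall n, simple_ok (sn n)) /\
  {ae leb, forall x, D x -> (fun n => simple_eval (sn n) x) @ \oo --> f x} /\
  ((fun n => (\int[leb]_(x in D) (`|f x - simple_eval (sn n) x|)%:E)%E)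
     @ \oo --> 0%E).

Definition bochner_integrable (Y : normedModType R) (D : set R) (f : R -> Y) : Prop :=
  exists sn, @bochner_approx Y D f sn.

(** the Bochner integral int_D f (0 by convention if f is not integrable) *)
Definition bint (Y : normedModType R) (D : set R) (f : R -> Y) : Y :=
  xget 0 [set v | exists sn, @bochner_approx Y D f sn /\
                    (fun n => simple_int D (sn n)) @ \oo --> v].

Definition regular (Y1 Y : normedModType R) (iota : Y1 -> Y) (J : set R)
    (Gam : R -> R -> Y -> Y) : Prop :=
  (forall f : Y1, in_dom_genJ J Gam (iota f)) /\
  (forall s t, J s -> J t -> s <= t ->
     forall f : Y1, exists g : Y1, iota g = Gam s t (iota f)) /\
  (forall (f : Y1) t, J t ->
     exists phi : R -> Y1,
       (forall u, J u -> u <= t -> iota (phi u) = Gam u t (iota f)) /\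
       {within [set u | J u /\ u <= t], continuous phi}) /\
  (forall (f : Y) s, J s ->
     {within [set u | J u /\ s <= u], continuous (fun u => Gam s u f)}) /\
  (forall s t, J s -> J t -> s <= t -> forall f : Y1,
     bochner_integrable `[s, t]%classic (fun u => Gam s u (Agen J Gam u (iota f)))).

Definition dom_AY1 (Y1 Y : normedModType R) (iota : Y1 -> Y) J Gam (f : Y) : Prop :=
  in_dom_genJ J Gam f /\ (exists f1 : Y1, iota f1 = f) /\
  (forall t, J t -> exists g : Y1, iota g = Agen J Gam t f).

(** d = A'_Gamma(t) f, a limit in the Y1-norm *)
Definition is_Aprime (Y1 Y : normedModType R) (iota : Y1 -> Y) J Gam
    (t : R) (f : Y) (d : Y1) : Prop :=
  (fun h => h^-1 *: (preim iota (Agen J Gam (t + h) f) - preim iota (Agen J Gam t f)))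
    @ within [set h | J (t + h)] 0^' --> d.

Definition dom_Aprime (Y1 Y : normedModType R) (iota : Y1 -> Y) J Gam (f : Y) : Prop :=
  dom_AY1 iota J Gam f /\
  forall t, J t -> exists d : Y1, is_Aprime iota J Gam t f d.

Definition Aprime (Y1 Y : normedModType R) (iota : Y1 -> Y) J Gam
    (t : R) (f : Y) : Y1 :=
  xget 0 [set d | is_Aprime iota J Gam t f d].

Definition Y1_strongly_continuous (Y1 Y : normedModType R) (iota : Y1 -> Y) J Gam
  : Prop :=
  forall f : Y1, {within J, continuous (fun u => Agen J Gam u (iota f))}.

End Defs.

(* Main.v *)
Require Import Defs.
From HB Require Import structures.
From mathcomp Require Import all_boot all_order all_algebra.
From mathcomp Require Import all_classical all_reals all_analysis.
From mathcomp Require Import measurable_realfun ring.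
Import Order.TTheory GRing.Theory Num.Theory.
Import numFieldNormedType.Exports.
Local Open Scope classical_set_scope.
Local Open Scope ring_scope.

(** For [f] in [Y1] the orbit [u |-> Gam s u f] is continuous and has right
    derivative [Gam s u (A u f)] at every point, so the first expansion amounts to
    the fundamental theorem of calculus, applied to [f] and then to [A u f]. The
    derivative is only Bochner integrable, not continuous. Write it as a simple
    function up to a small [L1] error, approximate that by a continuous function,
    and bound the remainder by a mean value inequality: if the right derivative of
    [G] is bounded by [psi], then [|G b - G a| <= \int psi], by comparison with a
    lower semicontinuous majorant of [psi] (Vitali-Caratheodory).

    The orbit formula turns the inner integral of the first expansion into
    [phi u = Gam s u (A u f) - A u f]. Its right derivative is
    [Gam s u (A u (A u f)) + (Gam s u (A' u f) - A' u f)], where the parenthesis is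
    again an inner integral; the product rule needs the uniform bound on [Gam s u]
    given by the Banach-Steinhaus theorem. The second expansion is the fundamental
    theorem for [(t - u) *: phi u], which vanishes at both ends. *)

Set Implicit Arguments.
Unset Strict Implicit.
Unset Printing Implicit Defensive.

(** * Borel versus completed Lebesgue measure, and simple functions *)

Section completed_vs_borel.
Context {R : realType}.
Notation leb := (@completed_lebesgue_measure R).
Notation mu := (@lebesgue_measure R).
Local Open Scope ereal_scope.

Lemma completed_lebesgue_measurable_id :
  measurable_fun [set: caratheodory_type (@wlength R idfun)^*%mu]
    (idfun : caratheodory_type (@wlength R idfun)^*%mu -> measurableTypeR R).
Proof. by move=> _ B mB; rewrite setTI; exact: sub_caratheodory. Qed.

Lemma completed_measurable_fun d' (T' : measurableType d') (D : set R) (f : R -> T') :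
  measurable_fun (D : set (measurableTypeR R)) f ->
  measurable (D : set (measurableTypeR R)) ->
  measurable_fun (D : set (caratheodory_type (@wlength R idfun)^*%mu)) f.
Proof.
by move=> mf mD _ B mB; apply: sub_caratheodory; exact: mf.
Qed.

(** The identity is measurable from the completed to the Borel sigma-algebra, and the pushforward of
    [leb] along it is [mu]; the change of variables formula gives the equality. *)
Lemma ge0_integral_completed (D : set R) (f : R -> \bar R) :
  measurable D -> measurable_fun D f -> (forall x, D x -> 0 <= f x) ->
  \int[leb]_(x in D) f x = \int[mu]_(x in D) f x.
Proof.
move=> mD mf f0.
have := @ge0_integral_pushforward _ _ _ _ R _ completed_lebesgue_measurable_id
  leb D f mD mf.
rewrite preimage_id => <- ; last by move=> x /set_mem; exact: f0.
by apply: eq_measure_integral; first exact: completed_lebesgue_measurable_id.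
Qed.

(** A G-delta hull with the same outer measure is Borel, hence serves as the null cover. *)
Lemma completed_negligible_cover (A : set R) : leb.-negligible A ->
  exists N : set R, [/\ measurable N, mu N = 0 & A `<=` N].
Proof.
move=> [B [mB B0 AB]].
have [G [oG BG muG]] := @outer_measure_Gdelta R B.
exists (\bigcap_i G i); split; last exact: subset_trans BG.
- by apply: bigcapT_measurable => i; exact: open_measurable.
- by rewrite muG.
Qed.

End completed_vs_borel.

Section simple_functions.
Context {R : realType} {Y : normedModType R}.
Notation leb := (@completed_lebesgue_measure R).
Notation mu := (@lebesgue_measure R).
Implicit Types (D A : set R) (l : seq (set R * Y)).

Lemma simple_ok_cons p l : @simple_ok R Y (p :: l) <->
  [/\ measurable p.1, (mu p.1 < +oo)%E & simple_ok l].
Proof.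
split=> [h|[h1 h2 h3] q].
- have [? ?] := h p (mem_head _ _); split => // q ql.
  by apply: h; rewrite inE ql orbT.
- by rewrite inE => /predU1P[->//|/h3].
Qed.

Lemma simple_ok_cat l1 l2 : simple_ok l1 -> simple_ok l2 -> simple_ok (l1 ++ l2).
Proof. by move=> h1 h2 p; rewrite mem_cat => /orP[/h1|/h2]. Qed.

Lemma simple_eval_cons p l x :
  simple_eval (p :: l) x = (\1_(p.1) x : R) *: p.2 + simple_eval l x.
Proof. by rewrite /simple_eval big_cons. Qed.

Lemma simple_eval_cat l1 l2 x :
  simple_eval (l1 ++ l2) x = simple_eval l1 x + simple_eval l2 x.
Proof. by rewrite /simple_eval big_cat. Qed.

Lemma simple_int_cat D l1 l2 :
  simple_int D (l1 ++ l2) = simple_int D l1 + simple_int D l2.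
Proof. by rewrite /simple_int big_cat. Qed.

Definition simple_opp l : seq (set R * Y) := [seq (p.1, - p.2) | p <- l].

Lemma simple_opp_ok l : simple_ok l -> simple_ok (simple_opp l).
Proof. by move=> h _ /mapP[p /h[? ?] ->]. Qed.

Lemma simple_eval_opp l x : simple_eval (simple_opp l) x = - simple_eval l x.
Proof.
rewrite /simple_eval big_map -sumrN.
by apply: eq_bigr => p _; rewrite scalerN.
Qed.

Lemma simple_int_opp D l : simple_int D (simple_opp l) = - simple_int D l.
Proof.
rewrite /simple_int big_map -sumrN.
by apply: eq_bigr => p _; rewrite scalerN.
Qed.

(** [Y] carries no sigma-algebra here, so measurability is tested on compositions with a
    parametrised map [k]. The induction splits [D] along the head set and absorbs the head vector
    into [k]. *)
Lemma measurable_fun_simple_comp d (T' : measurableType d)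
    (k : R -> Y -> T') D l : measurable D -> simple_ok l ->
  (forall z, measurable_fun D (k ^~ z)) ->
  measurable_fun D (fun x => k x (simple_eval l x)).
Proof.
elim: l k D => [|p l IH] k D mD; first by rewrite /simple_eval => _ h;
  under eq_fun do rewrite big_nil; exact: h.
move=> /simple_ok_cons[mp _ lok] mk.
rewrite -(setUIDK D p.1); apply/measurable_funU.
- exact: measurableI.
- exact: measurableD.
split.
- apply: (@eq_measurable_fun _ _ _ _ _ (fun x => k x (p.2 + simple_eval l x))).
    by move=> x /set_mem [_ px]; rewrite simple_eval_cons indicE mem_set// scale1r.
  apply: (IH (fun x z => k x (p.2 + z))) => //; first exact: measurableI.
  by move=> z; apply: measurable_funS (mk _) => //; exact: subIsetl.
- apply: (@eq_measurable_fun _ _ _ _ _ (fun x => k x (simple_eval l x))).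
    move=> x /set_mem [_ px]; rewrite simple_eval_cons indicE memNset//.
    by rewrite scale0r add0r.
  apply: (IH k) => //; first exact: measurableD.
  by move=> z; apply: measurable_funS (mk _) => //; exact: subIsetl.
Qed.

Lemma measurable_fun_norm_simpleB D l y : measurable D -> simple_ok l ->
  measurable_fun D (fun x => `|simple_eval l x - y|).
Proof.
by move=> mD lok; apply: (@measurable_fun_simple_comp _ _ (fun _ z => `|z - y|)).
Qed.

(** The sets of a list may overlap, so the triangle inequality cannot be read off term by term. The
    constant [y0] makes the induction work: on [D] intersected with the head set it becomes
    [y0 + p.2], on the rest of [D] it stays [y0]. *)
Lemma simple_int_norm_const D l (y0 : Y) : measurable D -> (mu D < +oo)%E ->
  simple_ok l ->
  (`|fine (mu D) *: y0 + simple_int D l|%:E <=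
    \int[mu]_(x in D) `|y0 + simple_eval l x|%:E)%E.
Proof.
elim: l D y0 => [|p l IH] D y0 mD Doo.
  move=> _; rewrite /simple_int /simple_eval.
  under eq_integral do rewrite big_nil addr0.
  rewrite big_nil addr0 integral_cst//= normrZ ger0_norm ?fine_ge0//.
  by rewrite EFinM fineK ?ge0_fin_numE// muleC.
move=> plok; have [mp _ lok] := (simple_ok_cons p l).1 plok.
have mDp : measurable (D `&` p.1) by exact: measurableI.
have mDNp : measurable (D `\` p.1) by exact: measurableD.
have leD A : measurable A -> A `<=` D -> (mu A < +oo)%E.
  by move=> mA AD; apply: le_lt_trans Doo; apply: le_measure => //; rewrite inE.
have oo1 := leD _ mDp (@subIsetl _ _ _).
have oo2 := leD _ mDNp (@subIsetl _ _ _).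
have split_mu A : measurable A ->
    fine (mu (A `&` D)) = fine (mu (A `&` (D `&` p.1))) + fine (mu (A `&` (D `\` p.1))).
  move=> mA; rewrite -fineD ?ge0_fin_numE//.
  - rewrite -measureU//.
    + by rewrite -setIUr setUIDK.
    + exact: measurableI.
    + exact: measurableI.
    + by rewrite setIACA (_ : (D `&` p.1) `&` (D `\` p.1) = set0) ?setI0//;
        rewrite -subset0 => x [[_ +] [_]].
  - by apply: leD; [exact: measurableI|move=> x [_ []]].
  - by apply: leD; [exact: measurableI|move=> x [_ []]].
rewrite -[in leRHS](setUIDK D p.1) ge0_integral_setU//; last 2 first.
- rewrite setUIDK; apply/measurable_EFinP.
  apply: (eq_measurable_fun (fun x => `|simple_eval (p :: l) x - (- y0)|)).
    by move=> x _; rewrite opprK addrC.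
  by apply: measurable_fun_norm_simpleB => //.
- by apply/disj_setPS => x [[_ ?] [_ /(_ _)]]; exact.
have := leeD (IH _ (y0 + p.2) mDp oo1 lok) (IH _ y0 mDNp oo2 lok).
rewrite -EFinD => h.
have -> : (\int[mu]_(x in D `&` p.1) `|y0 + simple_eval (p :: l) x|%:E =
   \int[mu]_(x in D `&` p.1) `|y0 + p.2 + simple_eval l x|%:E)%E.
  apply: eq_integral => x /set_mem[_ px].
  by rewrite simple_eval_cons indicE mem_set// scale1r addrA.
have -> : (\int[mu]_(x in D `\` p.1) `|y0 + simple_eval (p :: l) x|%:E =
   \int[mu]_(x in D `\` p.1) `|y0 + simple_eval l x|%:E)%E.
  apply: eq_integral => x /set_mem[_ px].
  by rewrite simple_eval_cons indicE memNset// scale0r add0r.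
apply: le_trans h; rewrite lee_fin; apply: le_trans (ler_normD _ _).
rewrite le_eqVlt; apply/orP; left; apply/eqP; congr (`| _ |).
have -> : simple_int D (p :: l) = fine (mu (D `&` p.1)) *: p.2
    + (simple_int (D `&` p.1) l + simple_int (D `\` p.1) l).
  rewrite /simple_int big_cons setIC; congr (_ + _).
  rewrite -big_split/= !big_seq; apply: eq_bigr => q ql.
  by rewrite -scalerDl -split_mu//; case: (lok q ql).
have := split_mu _ (@measurableT _ _); rewrite !setTI => ->.
rewrite scalerDl scalerDr !addrA; congr (_ + _).
by rewrite -!addrA; congr (_ + _); rewrite addrC -!addrA; congr (_ + _); rewrite addrC.
Qed.

Lemma simple_int_norm D l : measurable D -> (mu D < +oo)%E -> simple_ok l ->
  (`|simple_int D l|%:E <= \int[mu]_(x in D) `|simple_eval l x|%:E)%E.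
Proof.
move=> mD Doo lok; have := simple_int_norm_const 0 mD Doo lok.
by rewrite scaler0 add0r; under eq_integral do rewrite add0r.
Qed.

Lemma simple_int_null D N l : measurable D -> measurable N -> mu N = 0%E ->
  simple_ok l -> simple_int (D `\` N) l = simple_int D l.
Proof.
move=> mD mN N0 lok; rewrite /simple_int !big_seq; apply: eq_bigr => p /lok[mp _].
congr (fine _ *: _); rewrite -[LHS]/(mu _) -[RHS]/(mu _) setIDA.
have mpD : measurable (p.1 `&` D) by exact: measurableI.
have mpN : measurable (p.1 `&` D `&` N) by exact: measurableI.
have -> := measureDI mu mpD mN.
have pN0 : mu (p.1 `&` D `&` N) = 0%E.
  by apply: (subset_measure0 (mu := mu) mpN mN) => // x [].
by rewrite [X in (_ + X)%E]pN0 adde0.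
Qed.

End simple_functions.

(** * Bochner approximations in terms of Borel sets *)

Section bochner.
Context {R : realType} {Y : normedModType R}.
Notation leb := (@completed_lebesgue_measure R).
Notation mu := (@lebesgue_measure R).
Implicit Types (D A N : set R) (l : seq (set R * Y)).

Lemma integral_completed_null D N (h : R -> \bar R) :
  measurable D -> measurable N -> mu N = 0%E ->
  (forall x, D x -> (0 <= h x)%E) -> measurable_fun (D `\` N) h ->
  (\int[leb]_(x in D) h x = \int[mu]_(x in D `\` N) h x)%E.
Proof.
move=> mD mN N0 h0 mh.
have mDN : measurable (D `\` N) by exact: measurableD.
rewrite -ge0_integral_completed//; last by move=> x [/h0].
apply: ge0_negligible_integral => //; [exact: sub_caratheodory..|].
pose T := caratheodory_type (@wlength R idfun)^*%mu.
have mDT : measurable (D : set T) by exact: sub_caratheodory.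
have mNT : measurable (N : set T) by exact: sub_caratheodory.
rewrite -(setUIDK D N); apply/measurable_funU.
- exact: measurableI.
- exact: measurableD.
split; last exact: completed_measurable_fun.
(* On the null part [D] intersected with [N], measurability of [h] comes from completeness: there
   [h] equals [0] almost everywhere. *)
apply: (ae_measurable_fun (@completed_lebesgue_measure_is_complete R)
  (f := cst 0%E)); last exact: measurable_cst.
exists N; split => // x /= /not_implyP[[]] //.
Qed.

(** A pointwise limit of the measurable functions obtained from simple ones. Bochner measurability
    of [f] is only ever used through such scalar functions. *)
Lemma measurable_fun_bochner_comp (k : R -> Y -> R) D (f : R -> Y) sn :
  measurable D -> (forall n : nat, simple_ok (sn n)) ->
  (forall z, measurable_fun D (k ^~ z)) -> (forall x, D x -> continuous (k x)) ->
  (forall x, D x -> simple_eval (sn n) x @[n --> \oo] --> f x) ->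
  measurable_fun D (fun x => k x (f x)).
Proof.
move=> mD snok mk ck sf.
apply: (measurable_fun_cvg (h := fun n x => k x (simple_eval (sn n) x))).
- by move=> n; exact: (measurable_fun_simple_comp).
- by move=> x Dx; apply: continuous_cvg; [exact: ck|exact: sf].
Qed.

Lemma measurable_fun_norm_bochnerB D (f : R -> Y) sn l : measurable D ->
  (forall n : nat, simple_ok (sn n)) -> simple_ok l ->
  (forall x, D x -> simple_eval (sn n) x @[n --> \oo] --> f x) ->
  measurable_fun D (fun x => `|f x - simple_eval l x|).
Proof.
move=> mD snok lok sf.
apply: (measurable_fun_bochner_comp (k := fun x z => `|z - simple_eval l x|)
  (sn := sn)) => //.
- move=> z; under eq_fun do rewrite distrC.
  exact: measurable_fun_norm_simpleB.
- move=> x Dx z; apply: cvg_norm; apply: cvgB; [exact: cvg_id|exact: cvg_cst].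
Qed.

(* The exceptional null set can be taken Borel, after which only Borel
   measurable functions and the uncompleted measure are involved. *)
Lemma bochner_approxP D (f : R -> Y) sn : measurable D ->
  bochner_approx D f sn <->
  (forall n, simple_ok (sn n)) /\
  exists N, [/\ measurable N, mu N = 0%E,
    (forall x, (D `\` N) x -> simple_eval (sn n) x @[n --> \oo] --> f x) &
    (\int[mu]_(x in D `\` N) `|f x - simple_eval (sn n) x|%:E)%E @[n --> \oo] --> 0%E].
Proof.
move=> mD; have intE N n : (forall n, simple_ok (sn n)) -> measurable N -> mu N = 0%E ->
    (forall x, (D `\` N) x -> simple_eval (sn n) x @[n --> \oo] --> f x) ->
    (\int[leb]_(x in D) `|f x - simple_eval (sn n) x|%:E =
    \int[mu]_(x in D `\` N) `|f x - simple_eval (sn n) x|%:E)%E.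
  move=> snok mN N0 cv; apply: integral_completed_null => //.
  apply/measurable_EFinP.
  by apply: (measurable_fun_norm_bochnerB (sn := sn)) => //; exact: measurableD.
split=> [[snok [ae cvI]]|[snok [N [mN N0 cv cvI]]]].
- split => //; have [N [mN N0 sub]] := completed_negligible_cover ae.
  have cv x : (D `\` N) x -> simple_eval (sn n) x @[n --> \oo] --> f x.
    by move=> [Dx Nx]; apply: contrapT => h; apply: Nx; apply: sub => /= /(_ Dx).
  exists N; split => //.
  by under eq_fun do rewrite -intE//.
- split => //; split; last by under eq_fun do rewrite (intE N)//.
  exists N; split => //; first exact: sub_caratheodory.
  by move=> x /= /not_implyP[Dx h]; apply: contrapT => Nx; apply: h; exact: cv.
Qed.

End bochner.

(** * The Bochner integral *)

Section bochner_integral.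
Context {R : realType} {Y : completeNormedModType R}.
Notation leb := (@completed_lebesgue_measure R).
Notation mu := (@lebesgue_measure R).
Implicit Types (D A N : set R) (l : seq (set R * Y)).

(** The triangle inequality through [f], applied to the simple function [l1 - l2]. Two terms of one
    sequence give the Cauchy property, terms of two sequences give independence of the limit. *)
Lemma simple_intB_le D (f : R -> Y) sn l1 l2 : measurable D -> (mu D < +oo)%E ->
  bochner_approx D f sn -> simple_ok l1 -> simple_ok l2 ->
  (`|simple_int D l1 - simple_int D l2|%:E <=
    \int[leb]_(x in D) `|f x - simple_eval l1 x|%:E +
    \int[leb]_(x in D) `|f x - simple_eval l2 x|%:E)%E.
Proof.
move=> mD Doo /(bochner_approxP _ _ mD)[snok [N [mN N0 cv _]]] ok1 ok2.
have mDN : measurable (D `\` N) by exact: measurableD.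
have mf l : simple_ok l -> measurable_fun (D `\` N) (fun x => `|f x - simple_eval l x|%:E).
  by move=> lok; apply/measurable_EFinP; apply: (measurable_fun_norm_bochnerB (sn := sn)).
have ok12 : simple_ok (l1 ++ simple_opp l2).
  by apply: simple_ok_cat => //; exact: simple_opp_ok.
rewrite (integral_completed_null mD mN N0) ?(integral_completed_null mD mN N0)//;
  [|exact: mf..].
rewrite -ge0_integralD//; [|exact: mf..].
rewrite -(simple_int_null mD mN N0 ok1) -(simple_int_null mD mN N0 ok2).
rewrite -simple_int_opp -simple_int_cat.
apply: (le_trans (simple_int_norm mDN _ ok12)).
  by apply: le_lt_trans Doo; apply: le_measure; rewrite ?inE//; exact: subDsetl.
apply: ge0_le_integral => //.
- apply/measurable_EFinP.
  apply: (eq_measurable_fun (fun x => `|simple_eval (l1 ++ simple_opp l2) x - 0|)).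
    by move=> x _; rewrite subr0.
  exact: measurable_fun_norm_simpleB.
- by apply: emeasurable_funD; exact: mf.
- move=> x _; rewrite -EFinD lee_fin simple_eval_cat simple_eval_opp.
  rewrite -[X in `|X|](subrKA (f x)) [X in _ <= X + _]distrC.
  exact: ler_normD.
Qed.

Lemma bochner_approx_cvgB D (f : R -> Y) sn tn : measurable D -> (mu D < +oo)%E ->
  bochner_approx D f sn -> bochner_approx D f tn ->
  simple_int D (sn n) - simple_int D (tn n) @[n --> \oo] --> 0.
Proof.
move=> mD Doo sf tf; apply/norm_cvg0P.
have [snok [_ cs]] := sf; have [tnok [_ ct]] := tf.
have bnd n := simple_intB_le mD Doo sf (snok n) (tnok n).
have : (`|simple_int D (sn n) - simple_int D (tn n)|%:E) @[n --> \oo] --> 0%:E.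
  apply: (squeeze_cvge _ (cvg_cst 0%E) (_ : _ --> 0%E)); last first.
    by rewrite -[X in _ --> X]adde0; apply: cvgeD; [| exact: cs|exact: ct].
  by apply: nearW => n; rewrite bnd lee_fin normr_ge0.
by move/fine_cvgP => [].
Qed.

Lemma bochner_approx_is_cvg D (f : R -> Y) sn : measurable D -> (mu D < +oo)%E ->
  bochner_approx D f sn -> cvg (simple_int D (sn n) @[n --> \oo]).
Proof.
move=> mD Doo sf; apply/cauchy_cvgP/cauchy_ballP => e e0.
have [snok [_ cs]] := sf.
have bnd n m := simple_intB_le mD Doo sf (snok n) (snok m).
have e20 : 0 < e / 2 by rewrite divr_gt0.
have ev : \forall n \near \oo,
   (\int[leb]_(x in D) `|f x - simple_eval (sn n) x|%:E < (e / 2)%:E)%E.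
  have /cs : nbhs (0%E : \bar R) [set y | (y < (e / 2)%:E)%E].
    by apply: open_ereal_lt'; rewrite lte_fin.
  by [].
rewrite near_map2; near=> n m.
rewrite -ball_normE /= -lte_fin (le_lt_trans (bnd _ _))//.
rewrite (splitr e) EFinD lteD//; [near: n|near: m]; exact: ev.
Unshelve. all: by end_near. Qed.

(** [bint] picks a limit along some unspecified sequence [tn]; the integrals along [sn] and [tn]
    differ by a null sequence, so any approximating sequence computes it. *)
Lemma bint_cvg D (f : R -> Y) sn : measurable D -> (mu D < +oo)%E ->
  bochner_approx D f sn -> simple_int D (sn n) @[n --> \oo] --> bint D f.
Proof.
move=> mD Doo sf.
have /cvg_ex[v sv] := bochner_approx_is_cvg mD Doo sf.
have [tn [tf tv]] : exists tn, bochner_approx D f tn /\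
    simple_int D (tn n) @[n --> \oo] --> bint D f.
  by rewrite /bint; case: xgetP => [w -> //|/(_ v)[]]; exists sn.
rewrite (_ : (fun n => _) = (fun n => (simple_int D (sn n) - simple_int D (tn n))
    + simple_int D (tn n))); last by apply/funext => n; rewrite subrK.
by rewrite -[X in _ --> X]add0r; apply: cvgD => //; exact: (bochner_approx_cvgB mD Doo sf tf).
Qed.

Lemma eq_bochner_approx D (f g : R -> Y) sn : (forall x, D x -> f x = g x) ->
  bochner_approx D f sn -> bochner_approx D g sn.
Proof.
move=> fg [snok [cv cvI]]; split => //; split.
- case: cv => N [mN N0 sub]; exists N; split => // x /= h; apply: sub => /= k.
  by apply: h => Dx; rewrite -fg//; exact: k.
- rewrite (_ : (fun n => _) = (fun n =>
    \int[leb]_(x in D) `|f x - simple_eval (sn n) x|%:E)%E)//.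
  by apply/funext => n; apply: eq_integral => x /set_mem Dx; rewrite fg.
Qed.

Lemma eq_bochner_integrable D (f g : R -> Y) : (forall x, D x -> f x = g x) ->
  bochner_integrable D f -> bochner_integrable D g.
Proof. by move=> fg [sn /(eq_bochner_approx fg) ?]; exists sn. Qed.

Lemma eq_bint D (f g : R -> Y) : (forall x, D x -> f x = g x) ->
  bint D f = bint D g.
Proof.
move=> fg; rewrite /bint; congr (xget _ _); apply/seteqP.
by split=> v /= [sn [h cv]]; exists sn; split => //; apply: eq_bochner_approx h => // x /fg.
Qed.

Lemma bochner_approxD D (f g : R -> Y) sn tn : measurable D ->
  bochner_approx D f sn -> bochner_approx D g tn ->
  bochner_approx D (fun x => f x + g x) (fun n => sn n ++ tn n).
Proof.
move=> mD /(bochner_approxP _ _ mD)[snok [N [mN N0 cs Is]]].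
move=> /(bochner_approxP _ _ mD)[tnok [M [mM M0 ct It]]].
apply/(bochner_approxP _ _ mD); split; first by move=> n; exact: simple_ok_cat.
have mNM : measurable (N `|` M) by exact: measurableU.
have mDNM : measurable (D `\` (N `|` M)) by exact: measurableD.
exists (N `|` M); split => //.
- by rewrite measureU0.
- move=> x [Dx NMx]; under eq_fun do rewrite simple_eval_cat.
  by apply: cvgD; [apply: cs|apply: ct]; split => // ?; apply: NMx; [left|right].
have subN : D `\` (N `|` M) `<=` D `\` N by move=> x [? h]; split => // ?; apply: h; left.
have subM : D `\` (N `|` M) `<=` D `\` M by move=> x [? h]; split => // ?; apply: h; right.
have mf n : measurable_fun (D `\` N) (fun x => `|f x - simple_eval (sn n) x|%:E).
  apply/measurable_EFinP; apply: (measurable_fun_norm_bochnerB (sn := sn)) => //.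
  exact: measurableD.
have mg n : measurable_fun (D `\` M) (fun x => `|g x - simple_eval (tn n) x|%:E).
  apply/measurable_EFinP; apply: (measurable_fun_norm_bochnerB (sn := tn)) => //.
  exact: measurableD.
apply: (squeeze_cvge _ (cvg_cst 0%E) (_ : _ --> 0%E)); last first.
  by rewrite -[X in _ --> X]adde0; apply: cvgeD; [| exact: Is|exact: It].
apply: nearW => n; rewrite integral_ge0//=.
apply: (@le_trans _ _ (\int[mu]_(x in D `\` (N `|` M)) (`|f x - simple_eval (sn n) x|%:E
   + `|g x - simple_eval (tn n) x|%:E))%E).
  apply: ge0_le_integral => //.
  - apply/measurable_EFinP.
    apply: (@measurable_fun_norm_bochnerB _ _ _ _ (fun n => sn n ++ tn n)) => //.
    + by move=> m; exact: simple_ok_cat.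
    + exact: simple_ok_cat.
    + move=> x NMx; under eq_fun do rewrite simple_eval_cat.
      by apply: cvgD; [apply/cs/subN|apply/ct/subM].
  - by apply: emeasurable_funD; [apply: measurable_funS (mf n) => //; exact: measurableD|
      apply: measurable_funS (mg n) => //; exact: measurableD].
  - move=> x _; rewrite -EFinD lee_fin simple_eval_cat opprD addrACA.
    exact: ler_normD.
rewrite ge0_integralD//.
- apply: leeD; apply: ge0_subset_integral => //.
  + exact: measurableD.
  + exact: mf.
  + exact: measurableD.
  + exact: mg.
- by apply: measurable_funS (mf n) => //; exact: measurableD.
- by apply: measurable_funS (mg n) => //; exact: measurableD.
Qed.

Lemma bochner_integrableD D (f g : R -> Y) : measurable D ->
  bochner_integrable D f -> bochner_integrable D g ->
  bochner_integrable D (fun x => f x + g x).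
Proof.
by move=> mD [sn sf] [tn tg]; exists (fun n => sn n ++ tn n); exact: bochner_approxD.
Qed.

Lemma bintD D (f g : R -> Y) : measurable D -> (mu D < +oo)%E ->
  bochner_integrable D f -> bochner_integrable D g ->
  bint D (fun x => f x + g x) = bint D f + bint D g.
Proof.
move=> mD Doo [sn sf] [tn tg].
have := bint_cvg mD Doo (bochner_approxD mD sf tg).
under eq_fun do rewrite simple_int_cat.
move=> h; rewrite -[LHS](cvg_lim _ h)//; apply: cvg_lim => //.
by apply: cvgD; exact: bint_cvg.
Qed.

End bochner_integral.

(** * An integrability criterion for separable spaces *)

Section separable_bochner.
Context {R : realType} {Y : normedModType R}.
Notation leb := (@completed_lebesgue_measure R).
Notation mu := (@lebesgue_measure R).
Implicit Types (D A N : set R) (l : seq (set R * Y)).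

Lemma separable_dense_seq : separable Y ->
  exists e : nat -> Y, forall y (r : R), 0 < r -> exists n, `|y - e n| < r.
Proof.
move=> [Q [/countable_injP[i iinj] clQ]].
(* Indices that [i] does not reach on [Q] get the default [0]; extra terms do not harm density. *)
exists (fun n => xget 0 [set y | Q y /\ i y = n]) => y r r0.
have : closure Q y by rewrite clQ.
move=> /(_ (ball y r)) []; first exact: nbhsx_ballx.
move=> z [Qz]; rewrite -ball_normE /= => yz; exists (i z).
have [] := @xgetPex _ 0 [set w | Q w /\ i w = i z] (ex_intro _ z (conj Qz erefl)).
by move=> Qw iw; rewrite (iinj _ _ _ _ iw)//; exact/mem_set.
Qed.

(** Overlapping entries add up, so giving the value [e] on [B] requires cutting [B] out of all other
    sets. *)
Definition simple_update (B : set R) (e : Y) l : seq (set R * Y) :=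
  (B, e) :: [seq (p.1 `\` B, p.2) | p <- l].

Lemma simple_update_ok B e l : measurable B -> (mu B < +oo)%E ->
  simple_ok l -> simple_ok (simple_update B e l).
Proof.
move=> mB Boo lok; apply/simple_ok_cons; split => // _ /mapP[p /lok[mp poo] ->] /=.
have mpB : measurable (p.1 `\` B) by exact: measurableD.
split => //; apply: le_lt_trans poo.
by apply: (le_measure mu); rewrite ?inE//; exact: subDsetl.
Qed.

Lemma simple_update_eval B e l x :
  simple_eval (simple_update B e l) x = if x \in B then e else simple_eval l x.
Proof.
rewrite simple_eval_cons indicE/= /simple_eval big_map.
case: ifPn => xB; rewrite ?scale1r ?scale0r ?add0r.
- rewrite big1 ?addr0// => p _; rewrite indicE/= memNset ?scale0r//.
  by move=> [_]; apply; exact/set_mem.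
- apply: eq_bigr => p _; rewrite !indicE/=; congr (_%:R *: _); congr nat_of_bool.
  apply/idP/idP => /set_mem; first by case=> /mem_set.
  by move=> px; apply/mem_set; split => // /mem_set; exact/negP.
Qed.

(* The n-th approximation takes, at each point, the value nearest to f among
   0, e 0, ..., e n.-1. *)
Fixpoint nearest_approx D (f : R -> Y) (e : nat -> Y) n : seq (set R * Y) :=
  if n is m.+1 then
    let l := nearest_approx D f e m in
    simple_update [set x | D x /\ `|f x - e m| < `|f x - simple_eval l x|] (e m) l
  else [::].

Lemma nearest_approx_ok D (f : R -> Y) e n : measurable D -> (mu D < +oo)%E ->
  (forall y, measurable_fun D (fun x => `|f x - y|)) ->
  simple_ok (nearest_approx D f e n).
Proof.
move=> mD Doo mf; elim: n => [|n IH] //=.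
set B := [set x | _]; have mB : measurable B.
  rewrite (_ : B = D `&` [set x | `|f x - e n| < `|f x - simple_eval (nearest_approx D f e n) x|])//.
  apply: measurable_fun_ltr => //.
  exact: (measurable_fun_simple_comp (k := fun x z => `|f x - z|)).
apply: simple_update_ok => //; apply: le_lt_trans Doo.
by apply: (le_measure mu); rewrite ?inE// => x [].
Qed.

Lemma nearest_approx_le0 D (f : R -> Y) e n x : D x ->
  `|f x - simple_eval (nearest_approx D f e n) x| <= `|f x|.
Proof.
move=> Dx; elim: n => [|n IH] /=; first by rewrite /simple_eval big_nil subr0.
rewrite simple_update_eval; case: ifPn => // /set_mem[_ /ltW h].
exact: le_trans IH.
Qed.

Lemma nearest_approx_le D (f : R -> Y) e n k x : D x -> (k < n)%N ->
  `|f x - simple_eval (nearest_approx D f e n) x| <= `|f x - e k|.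
Proof.
move=> Dx; elim: n => [//|n IH]; rewrite ltnS leq_eqVlt /= simple_update_eval.
move=> /predU1P[->|kn]; case: ifPn => //.
- by move=> /negP h; rewrite leNgt; apply/negP => h2; apply: h; apply/mem_set.
- by move=> /set_mem[_ /ltW h]; exact: le_trans (IH kn).
- by move=> _; exact: IH.
Qed.

(** A form of the theorems of Pettis and Bochner. The nearest approximations converge by density;
    since [0] is among the candidates, their error never exceeds the norm of [f], and dominated
    convergence applies. *)
Lemma separable_bochner_integrable D N (f : R -> Y) : separable Y ->
  measurable D -> (mu D < +oo)%E -> measurable N -> mu N = 0%E ->
  (forall y, measurable_fun (D `\` N) (fun x => `|f x - y|)) ->
  (\int[mu]_(x in D `\` N) `|f x|%:E < +oo)%E ->
  bochner_integrable D f.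
Proof.
move=> /separable_dense_seq[e eP] mD Doo mN N0 mf foo.
have mDN : measurable (D `\` N) by exact: measurableD.
have DNoo : (mu (D `\` N) < +oo)%E.
  by apply: le_lt_trans Doo; apply: (le_measure mu); rewrite ?inE//; exact: subDsetl.
pose sn := nearest_approx (D `\` N) f e.
have snok n : simple_ok (sn n) by exact: nearest_approx_ok.
have cv x : (D `\` N) x -> simple_eval (sn n) x @[n --> \oo] --> f x.
  move=> DNx; apply/cvgrPdist_lt => r r0; have [k fk] := eP (f x) r r0.
  near=> n; apply: le_lt_trans fk; apply: nearest_approx_le => //.
  by near: n; exists k.+1.
exists sn; apply/bochner_approxP => //; split => //; exists N; split => //.
have mn n : measurable_fun (D `\` N) (fun x => `|f x - simple_eval (sn n) x|).
  exact: (measurable_fun_simple_comp (k := fun x z => `|f x - z|)).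
have mf0 : measurable_fun (D `\` N) (fun x => `|f x|).
  by apply: eq_measurable_fun (mf 0) => x _; rewrite subr0.
have [] := @dominated_convergence _ _ _ mu _ mDN
  (fun n x => `|f x - simple_eval (sn n) x|%:E) (cst 0%E) (fun x => `|f x|%:E).
- by move=> n; apply/measurable_EFinP; exact: mn.
- exact: measurable_cst.
- apply: aeW => x DNx; apply: cvg_EFin; first by apply: nearW.
  rewrite [X in X @ _](_ : _ = fun n => `|f x - simple_eval (sn n) x|)//.
  rewrite -(normr0 Y); apply: cvg_norm; rewrite -(subrr (f x)).
  by apply: cvgB; [exact: cvg_cst|exact: cv].
- apply/integrableP; split; first by apply/measurable_EFinP.
  by under eq_integral do rewrite /= normr_id.
- by apply: aeW => x n DNx; rewrite /= normr_id lee_fin nearest_approx_le0.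
by move=> _ _; rewrite integral0.
Unshelve. all: by end_near. Qed.

End separable_bochner.

(** * A mean value inequality *)

Section mean_value.
Context {R : realType}.
Notation mu := (@lebesgue_measure R).

(* Vitali-Caratheodory: [w] is the sum of [d] times the indicators of open
   neighbourhoods of the level sets [psi >= k d]. *)
Lemma vitali_caratheodory (D : set R) (psi : R -> \bar R) (d : R) :
  measurable D -> (mu D < +oo)%E -> 0 < d ->
  measurable_fun D psi -> (forall x, D x -> 0 <= psi x)%E ->
  exists w : R -> \bar R, [/\ measurable_fun setT w, forall x, (0 <= w x)%E,
    forall x r, D x -> (r%:E <= psi x)%E -> \forall y \near x, (r%:E <= w y)%E &
    (\int[mu]_(x in D) w x <= \int[mu]_(x in D) psi x + (d%:E * mu D + d%:E))%E].
Proof.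
move=> mD Doo d0 mpsi psi0.
pose E k : set R := D `&` [set x | ((k%:R * d)%:E <= psi x)%E].
have mE k : measurable (E k) by exact: emeasurable_fun_c_infty.
have Eoo k : (mu (E k) < +oo)%E.
  by apply: le_lt_trans Doo; apply: (le_measure mu); [by apply/mem_set; exact: mE|exact/mem_set|exact: subIsetl].
have /choice[U UP] : forall k, exists U : set R, [/\ open U, E k `<=` U &
    (mu (U `\` E k) < (1 / (2 ^ k.+1)%:R)%:E)%E].
  move=> k; apply: (lebesgue_regularity_outer (mE k) (Eoo k)).
  by rewrite divr_gt0// ltr0n expn_gt0.
have oU k : open (U k) by have [] := UP k.
have EU k : E k `<=` U k by have [] := UP k.
have mU k : measurable (U k) by exact: open_measurable.
have Ule k : (mu (U k `&` D) <= mu (E k) + (1 / (2 ^ k.+1)%:R)%:E)%E.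
  have mUE : measurable (U k `\` E k) by exact: measurableD.
  apply: (@le_trans _ _ (mu (E k `|` U k `\` E k))).
    apply: (le_measure mu).
    - by apply/mem_set; apply: measurableI => //; exact: mU.
    - by apply/mem_set; apply: measurableU => //; exact: mE.
    - by move=> x [Ux _]; have [?|?] := pselect (E k x); [left|right].
  apply: (le_trans (measureU2 mu (mE k) mUE)).
  by rewrite leeD2l// ltW//; have [] := UP k.
pose w x := (\sum_(k <oo) (d%:E * (\1_(U k) x)%:E))%E.
have term0 (A : set R) x : (0 <= d%:E * (\1_A x)%:E)%E by rewrite mule_ge0// lee_fin ltW.
have mterm (B A : set R) : measurable A -> measurable_fun B (fun x => (d%:E * (\1_A x)%:E)%E).
  move=> mA; apply: measurable_funeM; apply/measurable_EFinP.
  exact: measurable_indic.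
have int_term (A : set R) : measurable A ->
    (\int[mu]_(x in D) (d%:E * (\1_A x)%:E) = d%:E * mu (A `&` D))%E.
  move=> mA; rewrite ge0_integralZl//; first by rewrite integral_indic.
  - by apply/measurable_EFinP; exact: measurable_indic.
  - by rewrite lee_fin ltW.
exists w; split.
- by apply: ge0_emeasurable_sum => // k _; exact: mterm.
- by move=> x; apply: nneseries_ge0.
- move=> x r Dx rpsi; have [r0|r0] := ltP r 0.
    apply: (@nearW _ (nbhs x)) => y; apply: (@le_trans _ _ 0%E).
      by rewrite lee_fin ltW.
    by apply: nneseries_ge0.
  (* Every [k < N] satisfies [k * d <= r <= psi x], so [x] lies in the first [N] open sets, and
     [N * d > r]. *)
  pose N := (Num.truncn (r / d)).+1.
  have UxN k : (k < N)%N -> U k x.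
    move=> kN; apply: EU; split => //=; apply: le_trans rpsi; rewrite lee_fin.
    rewrite -ler_pdivlMr//; apply: le_trans (_ : (Num.truncn (r / d))%:R <= _).
      by rewrite ler_nat.
    by rewrite truncn_le divr_ge0// ltW.
  have : nbhs x [set y | forall i : 'I_N, U i y].
    apply: (@filter_forall R _ (fun i : 'I_N => U i) (nbhs x)) => i; apply: open_nbhs_nbhs; split => //; exact: UxN.
  apply: (@filterS _ (nbhs x)) => y UN.
  apply: (@le_trans _ _ (\sum_(0 <= k < N) (d%:E * (\1_(U k) y)%:E))%E); last first.
    exact: nneseries_lim_ge.
  rewrite big_nat (eq_bigr (fun=> d%:E)); last first.
    by move=> k kN; rewrite indicE mem_set ?mule1//; exact: (UN (Ordinal kN)).
  rewrite -big_nat sumEFin lee_fin sumr_const_nat subn0 -mulr_natl.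
  rewrite -ler_pdivrMr//; apply: ltW; exact: truncnS_gt.
- rewrite integral_nneseries//; last by move=> k; exact: mterm.
  under eq_eseriesr do rewrite int_term//.
  have Ele : (\sum_(k <oo) (d%:E * mu (E k)) <= \int[mu]_(x in D) psi x + d%:E * mu D)%E.
    have -> : (\sum_(k <oo) (d%:E * mu (E k)) =
        \int[mu]_(x in D) \sum_(k <oo) (d%:E * (\1_(E k) x)%:E))%E.
      rewrite integral_nneseries//; last by move=> k; exact: mterm.
      apply: eq_eseriesr => k _; rewrite int_term//; congr (_ * mu _)%E.
      by rewrite setIidl//; exact: subIsetl.
    rewrite -integral_cst// -ge0_integralD//; last by move=> x _; rewrite lee_fin ltW.
    apply: ge0_le_integral => //.
    - by move=> x _; exact: nneseries_ge0.
    - by apply: ge0_emeasurable_sum => // k _; exact: mterm.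
    - by apply: emeasurable_funD.
    - move=> x Dx; apply: lime_le; first exact: is_cvg_nneseries.
      apply: nearW => n.
      (* The first bound feeds the second: if [x] is in [E n], the previous partial sum is at most
         [n * d <= psi x], so one more [d] stays below [psi x + d]. *)
      suff [] : (\sum_(0 <= k < n) (d%:E * (\1_(E k) x)%:E) <= (n%:R * d)%:E)%E /\
        (\sum_(0 <= k < n) (d%:E * (\1_(E k) x)%:E) <= psi x + d%:E)%E by [].
      elim: n => [|n [IH1 IH2]].
        rewrite big_nil mul0r; split => //.
        by rewrite adde_ge0 ?psi0// lee_fin ltW.
      rewrite big_nat_recr//= indicE.
      have [/set_mem[_ /= h]|_] := boolP (x \in E n).
        have h1 : (\sum_(0 <= k < n) (d%:E * (\1_(E k) x)%:E) + d%:E * 1%:E <= (n.+1%:R * d)%:E)%E.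
          by rewrite mule1 -natr1 mulrDl mul1r EFinD leeD2r.
        split=> //; apply: le_trans h1 _; rewrite -natr1 mulrDl mul1r EFinD.
        by rewrite leeD2r.
      rewrite mule0 adde0; split => //; apply: le_trans IH1 _.
      by rewrite lee_fin ler_pM2r// ler_nat.
  apply: (@le_trans _ _ (\sum_(k <oo) (d%:E * (mu (E k) + (1 / (2 ^ k.+1)%:R)%:E)))%E).
    by apply: lee_nneseries => k _; [rewrite mule_ge0// lee_fin ltW|
      rewrite lee_pmul2l// lte_fin].
  rewrite nneseriesZl//; last by move=> k _; rewrite adde_ge0// lee_fin divr_ge0.
  apply: (@le_trans _ _ (d%:E * (\sum_(k <oo) mu (E k) + 1%:E))%E).
    by rewrite lee_pmul2l// ?lte_fin//; exact: epsilon_trick.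
  rewrite ge0_muleDr//; last exact: nneseries_ge0.
  by rewrite mule1 -nneseriesZl// addeA leeD2r.
Qed.

Lemma lebesgue_measure_itvcc (a b : R) : a <= b -> mu `[a, b]%classic = (b - a)%:E.
Proof.
rewrite le_eqVlt => /predU1P[->|ab].
  by rewrite set_itv1 lebesgue_measure_set1 subrr.
by rewrite lebesgue_measure_itv/= lte_fin ab EFinB.
Qed.

Lemma within_itv_continuous_dist (Y : normedModType R) (a b c e : R) (G : R -> Y) :
  {within `[a, b], continuous G} -> a <= c <= b -> 0 < e ->
  exists2 r, 0 < r & forall x, a <= x <= b -> `|c - x| < r -> `|G c - G x| < e.
Proof.
move=> /subspace_continuousP cG cab e0.
have /cvgrPdist_lt/(_ e e0) : G x @[x --> within `[a, b]%classic (nbhs c)] --> G c.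
  by apply: cG; rewrite /= in_itv.
move=> /nbhs_ballP[r /= r0 h]; exists r => // x xab cx.
by apply: h; rewrite /= ?in_itv// -ball_normE.
Qed.

(* Unlike the classical mean value theorem, only the right derivative is used,
   and it need not be bounded. *)
Lemma mean_value_norm (Y : normedModType R) (a b : R) (G g : R -> Y)
    (psi : R -> \bar R) : a <= b ->
  {within `[a, b], continuous G} ->
  (forall x, a <= x < b -> h^-1 *: (G (x + h) - G x) @[h --> 0^'+] --> g x) ->
  measurable_fun `[a, b] psi ->
  (forall x, a <= x <= b -> (`|g x|%:E <= psi x)%E) ->
  (`|G b - G a|%:E <= \int[mu]_(x in `[a, b]) psi x)%E.
Proof.
move=> ab cG dG mpsi gpsi.
apply/lee_addgt0Pr => e e0.
have ba0 : 0 <= b - a by rewrite subr_ge0.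
(* The total error is [d * (b - a) + d] from the majorant [w] plus [d * (b - a)] from the slope
   allowance in [S], which adds up to [e]. *)
pose d := e / (2 * (b - a) + 1).
have den0 : 0 < 2 * (b - a) + 1 by rewrite ltr_pwDr// mulr_ge0.
have d0 : 0 < d by rewrite divr_gt0.
have mD : measurable `[a, b]%classic by exact: measurable_itv.
have muD := lebesgue_measure_itvcc ab.
have [||w [mw w0 wpsi wint]] := @vitali_caratheodory _ psi d mD _ d0 mpsi.
- by rewrite muD ltry.
- move=> x /=; rewrite in_itv/= => /gpsi; apply: le_trans.
  by rewrite lee_fin.
pose I x := (\int[mu]_(y in `[a, x]) w y)%E.
have mwS (A : set R) : measurable_fun A w by exact: measurable_funTS.
have I_nd x y : x <= y -> (I x <= I y)%E.
  move=> xy; apply: ge0_subset_integral => //; first exact: mwS.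
  by move=> z /=; rewrite !in_itv/= => /andP[-> /le_trans]; apply.
(* Supremum argument: continuity of [G] and monotonicity of [I] put [c = sup S] into [S], and
   [c < b] will be refuted by a point of [S] to the right of [c]. *)
pose S := [set x | a <= x <= b /\ (`|G x - G a|%:E <= I x + (d * (x - a))%:E)%E].
have Sa : S a.
  split; first by rewrite lexx ab.
  by rewrite !subrr normr0 mulr0 adde0; apply: integral_ge0.
have hasS : has_sup S by split; [exists a|exists b => x [/andP[]]].
pose c := sup S.
have ac : a <= c by exact: (sup_upper_bound hasS Sa).
have cb : c <= b by apply: ge_sup; [exists a|move=> x [/andP[]]].
have Pc : (`|G c - G a|%:E <= I c + (d * (c - a))%:E)%E.
  apply/lee_addgt0Pr => r r0.
  have [|q q0 hq] := within_itv_continuous_dist (c := c) cG _ r0; first by rewrite ac.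
  have [x Sx cqx] := sup_adherent q0 hasS.
  have xc : x <= c by exact: (sup_upper_bound hasS Sx).
  have [xab Px] := Sx.
  have GcGx : `|G c - G x| < r.
    by apply: hq => //; rewrite ger0_norm ?subr_ge0// ltrBlDr -ltrBlDl.
  rewrite -(subrKA (G x)) (@le_trans _ _ (`|G c - G x|%:E + `|G x - G a|%:E)%E)//.
    by rewrite -EFinD lee_fin ler_normD.
  rewrite [leRHS]addeC; apply: leeD; first by rewrite lee_fin ltW.
  apply: (le_trans Px); rewrite leeD// ?I_nd// lee_fin ler_pM2l//.
  by rewrite lerB.
(* If [c < b], then [w] is at least the norm of [g c] near [c], so [I] gains at least [h] times that
   norm over [[c, c + h]], while the right derivative bounds the move of [G] by this plus
   [h * d]. *)
have cE : c = b.
  apply/eqP; rewrite eq_le cb/= leNgt; apply/negP => cltb.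
  have := dG c; rewrite ac cltb => /(_ isT)/cvgrPdist_lt/(_ d d0) near1.
  have cin : `[a, b]%classic c by rewrite /= in_itv/= ac cb.
  have /nbhs_ballP[q /= q0 hq] : nbhs c [set y | (`|g c|%:E <= w y)%E].
    by apply: wpsi => //; apply: gpsi; rewrite ac.
  have : \forall h \near (0 : R)^'+, [/\ 0 < h, h < q, c + h <= b &
      `|g c - h^-1 *: (G (c + h) - G c)| < d].
    near=> h; split.
    - by near: h; exact: nbhs_right_gt.
    - by near: h; exact: nbhs_right_lt.
    - by rewrite -lerBrDl; near: h; apply: nbhs_right_le; rewrite subr_gt0.
    - by near: h.
  move=> /filter_ex[h [h0 hq' chb hd]].
  suff : S (c + h).
    by move=> /(sup_upper_bound hasS); rewrite gerDl leNgt h0.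
  have GG : `|G (c + h) - G c| <= h * (`|g c| + d).
    rewrite -ler_pdivrMl//.
    rewrite -[X in X * _](@gtr0_norm _ h^-1) ?invr_gt0// -normrZ.
    rewrite -lerBlDl; apply: le_trans (ltW hd).
    by rewrite distrC lerB_dist.
  split; first by rewrite chb andbT (le_trans ac)// lerDl ltW.
  have Ich : (I c + (h * `|g c|)%:E <= I (c + h)%R)%E.
    have -> : I (c + h) = (I c + \int[mu]_(y in `]c, (c + h)%R]) w y)%E.
      rewrite /I (@itv_bndbnd_setU _ _ _ (BRight c))//; [|by rewrite bnd_simp lerDl ltW].
      rewrite ge0_integral_setU//.
      - exact: mwS.
      - by apply/disj_setPS => z [] /=; rewrite !in_itv/= => /andP[_ zc] /andP[]; rewrite ltNge zc.
    rewrite leeD2l//.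
    apply: (@le_trans _ _ (\int[mu]_(y in `]c, (c + h)%R]) (cst `|g c|%:E) y)%E).
      rewrite integral_cst//= lebesgue_measure_itv/= lte_fin ltrDl h0.
      by rewrite -EFinB -EFinM addrAC subrr add0r mulrC.
    apply: ge0_le_integral => //.
    - by move=> y _; rewrite /= lee_fin.
    - exact: mwS.
    - move=> y /=; rewrite in_itv/= => /andP[cy ych]; apply: hq.
      rewrite -ball_normE /= distrC gtr0_norm ?subr_gt0// (le_lt_trans _ hq')//.
      by rewrite lerBlDl.
  rewrite -(subrKA (G c)) (@le_trans _ _ (`|G (c + h)%R - G c|%:E + `|G c - G a|%:E)%E)//.
    by rewrite -EFinD lee_fin ler_normD.
  apply: (@le_trans _ _ ((h * (`|g c| + d))%:E + (I c + (d * (c - a))%:E))%E).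
    by rewrite leeD// lee_fin.
  apply: (@le_trans _ _ ((I c + (h * `|g c|)%:E) + (d * (c + h - a))%:E)%E); last first.
    by rewrite leeD2r.
  rewrite -[leRHS]addeA [leLHS]addeCA -!EFinD leeD2l// lee_fin.
  by rewrite le_eqVlt; apply/orP; left; apply/eqP; ring.
rewrite cE in Pc; apply: (le_trans Pc).
apply: (@le_trans _ _ ((\int[mu]_(x in `[a, b]) psi x + (d%:E * mu `[a, b]%classic + d%:E))
   + (d * (b - a))%:E)%E); first by rewrite leeD2r.
rewrite muD; move: (\int[mu]_(x in `[a, b]) psi x)%E => P.
rewrite -!addeA leeD2l// -EFinM -!EFinD lee_fin.
have <- : d * (2 * (b - a) + 1) = e by rewrite /d divfK// gt_eqF.
by rewrite le_eqVlt; apply/orP; left; apply/eqP; ring.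
Unshelve. all: by end_near. Qed.

End mean_value.

(** * The fundamental theorem of calculus *)

Lemma subrACA (V : zmodType) (x y z t : V) : x - y - (z - t) = x - z - (y - t).
Proof. by rewrite opprD addrACA -opprD. Qed.

Lemma subr_telescope (V : zmodType) (x y z t : V) : x - y = x - z - (t - z) - (y - t).
Proof. by rewrite opprB subrKA opprB subrKA. Qed.

Section bochner_FTC.
Context {R : realType}.
Notation mu := (@lebesgue_measure R).

Lemma cvg_lte_near (u : nat -> \bar R) (e : R) : 0 < e -> u @ \oo --> 0%E ->
  \forall n \near \oo, (u n < e%:E)%E.
Proof.
move=> e0 cu; have /cu : nbhs (0%E : \bar R) [set y | (y < e%:E)%E].
  by apply: open_ereal_lt'; rewrite lte_fin.
by [].
Qed.

Lemma derivable_cvg_at_right (C : R -> R) (x l : R) :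
  derivable C x 1 -> derive1 C x = l ->
  h^-1 * (C (x + h) - C x) @[h --> 0^'+] --> l.
Proof.
move=> dC <-; apply: cvg_dnbhs_at_right.
rewrite derive1E /derive.
rewrite (_ : (fun h => h^-1 * _) = fun h => h^-1 *: ((C \o shift x) (h *: 1) - C x)).
  exact: dC.
by apply/funext => h /=; rewrite /GRing.scale/= mulr1 (addrC h).
Qed.

(** [c] is a continuous [L1]-approximation of the indicator and [C] a primitive of [c]. Since
    [C b - C a] is the integral of [c], the last bound is controlled by the same [L1] error. *)
Lemma indic_primitive (a b : R) (A : set R) (e : R) : a <= b -> measurable A -> 0 < e ->
  exists C c : R -> R, [/\ continuous c, {within `[a, b], continuous C},
   forall x, a <= x <= b -> h^-1 * (C (x + h) - C x) @[h --> 0^'+] --> c x,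
   (\int[mu]_(x in `[a, b]) `|\1_A x - c x|%:E < e%:E)%E &
   `|C b - C a - fine (mu (A `&` `[a, b]))| <= e].
Proof.
move=> ab mA e0; pose D := `[a, b]%classic.
have mD : measurable D by exact: measurable_itv.
have muD := lebesgue_measure_itvcc ab.
have Doo : (mu D < +oo)%E by rewrite muD ltry.
have ADoo : (mu (A `&` D) < +oo)%E.
  apply: le_lt_trans Doo; apply: (le_measure mu); last exact: subIsetr.
  - by apply/mem_set; exact: measurableI.
  - exact/mem_set.
have iA : mu.-integrable D (EFin \o (\1_A : R -> R)).
  apply/integrableP; split; first by apply/measurable_EFinP; exact: measurable_indic.
  apply: le_lt_trans ADoo; rewrite -(integral_indic mu)//.
  by rewrite le_eqVlt; apply/orP; left; apply/eqP/eq_integral => x _ /=; rewrite ger0_norm.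
have [c_ [cc ic cvc]] := approximation_continuous_integrable mD Doo iA.
have [n _ /(_ n (leqnn n)) cn] := cvg_lte_near e0 cvc.
(* Starting the integral at [a - 1] makes [a] an interior point, so that [C] is differentiable there
   too. *)
pose c := c_ n; pose C x := (\int[mu]_(y in `[a - 1, x]) c y)%R.
have dC x : a <= x <= b -> derivable C x 1 /\ derive1 C x = c x.
  move=> /andP[ax xb]; apply: (@continuous_FTC1_closed _ _ _ _ (x + 1)).
  - by rewrite ltrDl.
  - apply: continuous_compact_integrable; first exact: segment_compact.
    by apply: continuous_subspaceT; exact: cc.
  - by rewrite ltrBlDr (le_lt_trans ax)// ltrDl.
  - exact: cc.
have wC : {within `[a, b], continuous C}.
  by apply: derivable_within_continuous => x; rewrite in_itv => /dC[].
have cn' : (\int[mu]_(x in D) `|\1_A x - c x|%:E < e%:E)%E.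
  by apply: le_lt_trans cn; rewrite le_eqVlt; apply/orP; left.
exists C, c; split => //; first exact: cc.
  by move=> x /dC[dx ex]; exact: derivable_cvg_at_right.
have {ab} [abE|ab] : a = b \/ a < b by move: ab; rewrite le_eqVlt => /predU1P[]; [left|right].
  rewrite -abE subrr sub0r normrN set_itv1 (_ : mu _ = 0%E) ?normr0 ?ltW//.
  apply: (subset_measure0 (mu := mu) (B := [set a])) => //.
  - exact: measurableI.
  - exact: lebesgue_measure_set1.
have FTC : (\int[mu]_(x in D) (c x)%:E = (C b)%:E - (C a)%:E)%E.
  apply: continuous_FTC2 => //; first by apply: continuous_subspaceT; exact: cc.
  - have [_ Ca Cb] := (continuous_within_itvP _ ab).1 wC; split => // x.
    by rewrite in_itv/= => /andP[/ltW ax /ltW xb]; have [] := dC x; rewrite ?ax.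
  - by move=> x; rewrite in_itv/= => /andP[/ltW ax /ltW xb]; have [] := dC x; rewrite ?ax.
have AE : (\int[mu]_(x in D) (\1_A x)%:E = (fine (mu (A `&` D)))%:E)%E.
  by rewrite integral_indic// fineK// ge0_fin_numE.
have : (`|(C b - C a - fine (mu (A `&` D)))%:E| <= e%:E)%E.
  rewrite EFinB EFinB -FTC -AE -integralB_EFin//; last exact: ic.
  apply: le_trans; first apply: le_abse_integral => //.
    apply: emeasurable_funB; apply/measurable_EFinP.
    + by apply: measurable_funTS; exact: continuous_measurable_fun (cc n).
    + exact: measurable_indic.
  apply: ltW; apply: le_lt_trans cn'; rewrite le_eqVlt; apply/orP; left; apply/eqP.
  by apply: eq_integral => x _ /=; rewrite distrC.
by rewrite lee_fin.
Qed.

(** Each entry contributes the primitive of its indicator times its vector. The scalar majorant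
    [psi] collects the errors of the entries, so only scalar functions have to be measured and
    integrated. *)
Lemma simple_primitive (Y : normedModType R) (a b : R) (l : seq (set R * Y)) (e : R) :
  a <= b -> simple_ok l -> 0 < e ->
  exists (C c : R -> Y) (psi : R -> \bar R), [/\ {within `[a, b], continuous C},
   forall x, a <= x <= b -> h^-1 *: (C (x + h) - C x) @[h --> 0^'+] --> c x,
   measurable_fun `[a, b] psi /\
     (forall x, a <= x <= b -> (`|simple_eval l x - c x|%:E <= psi x)%E),
   (\int[mu]_(x in `[a, b]) psi x <= e%:E)%E &
   `|C b - C a - simple_int `[a, b] l| <= e].
Proof.
move=> ab; elim: l e => [|[A y] l IH] e.
  move=> _ e0; exists (cst 0), (cst 0), (cst 0%E); split.
  - by apply: continuous_subspaceT => x; exact: cvg_cst.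
  - move=> x _; rewrite (_ : (fun h => _) = cst 0); first exact: cvg_cst.
    by apply/funext => h; rewrite /= subrr scaler0.
  - split; first exact: measurable_cst.
    by move=> x _; rewrite /simple_eval big_nil subrr normr0.
  - by rewrite integral0 lee_fin ltW.
  - by rewrite /simple_int big_nil !subrr normr0 ltW.
move=> /simple_ok_cons[/= mA _ lok] e0.
have e20 : 0 < e / 2 by rewrite divr_gt0.
have [C1 [c1 [psi1 [wC1 dC1 [mpsi1 psi1P] int1 bnd1]]]] := IH _ lok e20.
have y0 : 0 < `|y| + 1 by rewrite ltr_wpDl.
(* The indicator error gets multiplied by the norm of [y], which may be [0]; hence the added [1] in
   the denominator. *)
have d0 : 0 < e / 2 / (`|y| + 1) by rewrite divr_gt0.
have [C [c [cc wC dC int bnd]]] := indic_primitive ab mA d0.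
have mD : measurable `[a, b]%classic by exact: measurable_itv.
have mAc : measurable_fun `[a, b] (fun x => `|\1_A x - c x|%:E).
  apply/measurable_EFinP; apply: measurableT_comp => //.
  apply: measurable_funB; first exact: measurable_indic.
  by apply: measurable_funTS; exact: continuous_measurable_fun.
have psi10 x : `[a, b]%classic x -> (0 <= psi1 x)%E.
  by rewrite /= in_itv/= => /psi1P; apply: le_trans; rewrite lee_fin.
exists (fun x => C x *: y + C1 x), (fun x => c x *: y + c1 x),
  (fun x => (`|y|%:E * `|\1_A x - c x|%:E + psi1 x)%E); split.
- move=> x; apply: (@continuousD _ _ (subspace `[a, b]%classic) (fun x => C x *: y) C1); last exact: wC1.
  apply: (@continuous_comp (subspace `[a, b]%classic) _ _ C (fun r => r *: y)); first exact: wC.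
  exact: scalel_continuous.
- move=> x xab.
  rewrite (_ : (fun h => _) = fun h => (h^-1 * (C (x + h) - C x)) *: y + h^-1 *: (C1 (x + h) - C1 x)).
    by apply: cvgD; [apply: cvgZr_tmp; exact: dC|exact: dC1].
  by apply/funext => h; rewrite opprD addrACA -scalerBl scalerDr scalerA.
- split.
    by apply: emeasurable_funD => //; exact: measurable_funeM.
  move=> x xab; rewrite simple_eval_cons/= opprD addrACA -scalerBl.
  apply: (@le_trans _ _ (`|(\1_A x - c x) *: y|%:E + `|simple_eval l x - c1 x|%:E)%E).
    by rewrite -EFinD lee_fin ler_normD.
  by rewrite leeD ?psi1P// normrZ mulrC EFinM.
- rewrite ge0_integralD//; last exact: measurable_funeM.
  rewrite ge0_integralZl//.
  rewrite (splitr e) EFinD leeD//.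
  apply: (@le_trans _ _ (`|y|%:E * (e / 2 / (`|y| + 1))%:E)%E).
    by rewrite lee_wpmul2l ?lee_fin// ltW.
  by rewrite -EFinM lee_fin mulrCA ler_piMr ?ltW// ltr_pdivrMr// mul1r ltrDl ltr01.
- rewrite /simple_int big_cons/= -/(simple_int `[a, b] l).
  rewrite (_ : _ - _ = (C b - C a - fine (mu (A `&` `[a, b]))) *: y +
     (C1 b - C1 a - simple_int `[a, b] l)); last first.
    by rewrite !scalerBl !opprD [X in X + _ = _]addrACA [LHS]addrACA.
  rewrite (splitr e) (le_trans (ler_normD _ _))// lerD// normrZ.
  apply: (@le_trans _ _ (e / 2 / (`|y| + 1) * `|y|)).
    by rewrite ler_wpM2r.
  by rewrite mulrAC -mulrA ler_piMr ?ltW// ltr_pdivrMr// mul1r ltrDl ltr01.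
Qed.

(** Four errors of size [e / 4]: the integral against that of a simple function, the latter against
    [C b - C a], and the two majorants [psi0] and [psi1] in the mean value inequality for
    [F - C]. *)
Lemma bochner_FTC (Y : completeNormedModType R) (a b : R) (F g : R -> Y) : a <= b ->
  {within `[a, b], continuous F} ->
  (forall x, a <= x < b -> h^-1 *: (F (x + h) - F x) @[h --> 0^'+] --> g x) ->
  bochner_integrable `[a, b] g ->
  bint `[a, b] g = F b - F a.
Proof.
move=> ab cF dF [sn sg].
have mD : measurable `[a, b]%classic by exact: measurable_itv.
have Doo : (mu `[a, b]%classic < +oo)%E by rewrite lebesgue_measure_itvcc// ltry.
apply/eqP; rewrite -subr_eq0 -normr_le0; apply/ler_addgt0Pr => e e0; rewrite add0r.
have e40 : 0 < e / 4 by rewrite divr_gt0.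
have := bint_cvg mD Doo sg => /cvgrPdist_lt/(_ _ e40) near1.
have [snok [N [mN N0 cv cvI]]] := (bochner_approxP _ _ mD).1 sg.
have near2 := cvg_lte_near e40 cvI.
have [n [n1 n2]] : exists n, `|bint `[a, b] g - simple_int `[a, b] (sn n)| < e / 4 /\
  (\int[mu]_(x in `[a, b] `\` N) `|g x - simple_eval (sn n) x|%:E < (e / 4)%:E)%E.
  exact: (filter_ex (filterI near1 near2)).
have mDN : measurable (`[a, b] `\` N) by exact: measurableD.
have [C [c [psi1 [wC dC [mpsi1 psi1P] int1 bnd1]]]] := simple_primitive ab (snok n) e40.
(* The mean value inequality needs a bound at every point; the value [+oo] provides it on the null
   set [N] without changing the integral. *)
pose psi0 x := if x \in N then +oo%E else `|g x - simple_eval (sn n) x|%:E.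
have mpsi0 : measurable_fun `[a, b] psi0.
  rewrite -(setUIDK `[a, b]%classic N); apply/measurable_funU => //; first exact: measurableI.
  split.
  - apply: (eq_measurable_fun (cst +oo%E)) => // x /set_mem[_ Nx].
    by rewrite /psi0 mem_set.
  - apply: (eq_measurable_fun (fun x => `|g x - simple_eval (sn n) x|%:E)).
      by move=> x /set_mem[_ Nx]; rewrite /psi0 memNset.
    by apply/measurable_EFinP; exact: (measurable_fun_norm_bochnerB (sn := sn)).
have psi00 x : (0 <= psi0 x)%E by rewrite /psi0; case: ifP => // _; rewrite lee_fin.
have psi10 x : `[a, b]%classic x -> (0 <= psi1 x)%E.
  by rewrite /= in_itv/= => /psi1P; apply: le_trans; rewrite lee_fin.
have mvt : (`|(F b - C b) - (F a - C a)|%:E <= \int[mu]_(x in `[a, b]) (psi0 x + psi1 x))%E.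
  apply: (mean_value_norm (G := fun x => F x - C x) (g := fun x => g x - c x)) => //.
  - by move=> x; apply: continuousB; [exact: cF|exact: wC].
  - move=> x /andP[ax xb].
    rewrite (_ : (fun h => _) = fun h => h^-1 *: (F (x + h) - F x) - h^-1 *: (C (x + h) - C x)).
      by apply: cvgB; [apply: dF; rewrite ax|apply: dC; rewrite ax ltW].
    by apply/funext => h; rewrite -scalerBr; congr (_ *: _); rewrite [LHS]subrACA.
  - exact: emeasurable_funD.
  - move=> x xab; rewrite /psi0; case: ifP => xN.
      by rewrite addye ?leey// gt_eqF// (lt_le_trans _ (psi10 x _))//= ?in_itv// ltNye.
    apply: (@le_trans _ _ (`|g x - simple_eval (sn n) x|%:E + `|simple_eval (sn n) x - c x|%:E)%E).
      by rewrite -EFinD lee_fin -[X in `|X|](subrKA (simple_eval (sn n) x)) ler_normD.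
    by rewrite leeD2l// psi1P.
have int0 : (\int[mu]_(x in `[a, b]) psi0 x <= (e / 4)%:E)%E.
  have -> := @ge0_negligible_integral _ _ _ mu _ _ _ mN mD mpsi0 (fun x _ => psi00 x) N0.
  apply: ltW; apply: le_lt_trans n2.
  rewrite le_eqVlt; apply/orP; left; apply/eqP; apply: eq_integral => x /set_mem[_ Nx].
  by rewrite /psi0 memNset.
have mvt' : `|(F b - C b) - (F a - C a)| <= e / 4 + e / 4.
  rewrite -lee_fin; apply: (le_trans mvt); rewrite ge0_integralD// EFinD.
  exact: leeD.
rewrite (_ : bint _ _ - _ = (bint `[a, b] g - simple_int `[a, b] (sn n))
   - ((C b - C a) - simple_int `[a, b] (sn n)) - ((F b - C b) - (F a - C a))); last first.
  by rewrite (subrACA (F b)); exact: subr_telescope.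
rewrite (_ : e = e / 4 + e / 4 + (e / 4 + e / 4)); last by field.
apply: (le_trans (ler_normB _ _)); apply: lerD => //.
apply: (le_trans (ler_normB _ _)); apply: lerD => //.
exact: ltW.
Qed.

End bochner_FTC.

(** * Bounded operators *)

Section bounded_operators.
Context {R : realType}.

Lemma bounded_op_linearB (U V : normedModType R) (T : U -> V) x y : bounded_op T ->
  T (x - y) = T x - T y.
Proof.
by move=> [lT _]; rewrite addrC -scaleN1r lT scaleN1r addrC.
Qed.

Lemma bounded_op0 (U V : normedModType R) (T : U -> V) : bounded_op T -> T 0 = 0.
Proof. by move=> bT; rewrite -(subrr 0) bounded_op_linearB// subrr. Qed.

Lemma bounded_op_linearZ (U V : normedModType R) (T : U -> V) k x : bounded_op T ->
  T (k *: x) = k *: T x.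
Proof.
by move=> bT; rewrite -[k *: x]addr0 bT.1 bounded_op0// addr0.
Qed.

Lemma bounded_op_bound (U V : normedModType R) (T : U -> V) : bounded_op T ->
  exists2 M : R, 0 < M & forall x, `|T x| <= M * `|x|.
Proof.
move=> [_ [C hC]]; exists (`|C| + 1); first by rewrite ltr_wpDl.
move=> x; apply: (le_trans (hC x)); rewrite ler_wpM2r//.
by rewrite (le_trans (ler_norm C))// lerDl.
Qed.

Lemma bounded_op_norm_le (U V : normedModType R) (T : U -> V) x : bounded_op T ->
  `|T x| <= opnorm T * `|x|.
Proof.
move=> bT; have [M M0 hM] := bounded_op_bound bT.
have [->|x0] := eqVneq x 0; first by rewrite bounded_op0// !normr0 mulr0.
have nx0 : 0 < `|x| by rewrite normr_gt0.
rewrite -ler_pdivrMr//.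
have hs : has_sup [set `|T z| | z in [set z : U | `|z| <= 1]].
  split; first by exists `|T 0|; exists 0 => //=; rewrite normr0.
  exists M => _ [z /= z1 <-]; apply: (le_trans (hM z)).
  by rewrite ler_piMr// ltW.
apply: (sup_upper_bound hs); exists (`|x|^-1 *: x) => /=.
  by rewrite normrZ ger0_norm ?invr_ge0// mulVf// gt_eqF.
by rewrite bounded_op_linearZ// normrZ ger0_norm ?invr_ge0// mulrC.
Qed.

(** Strong convergence of the operators plus a common Lipschitz constant lets operator and argument
    vary together: the difference of [T i (z i)] and [T i z0] is at most [M] times that of [z i] and
    [z0]. *)
Lemma cvg_lipschitz_family (U V : normedModType R) (I : Type) (F : set_system I)
    {FF : Filter F} (T : I -> U -> V) (z : I -> U) (z0 : U) (l : V) (M : R) :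
  (\forall i \near F, forall x y, `|T i x - T i y| <= M * `|x - y|) ->
  z @ F --> z0 -> (fun i => T i z0) @ F --> l -> (fun i => T i (z i)) @ F --> l.
Proof.
move=> hT cz cT.
rewrite (_ : (fun i => _) = fun i => (T i (z i) - T i z0) + T i z0); last first.
  by apply/funext => i; rewrite subrK.
rewrite -[X in _ --> X]add0r; apply: cvgD => //.
apply/cvgr0Pnorm_lt => e e0.
have M1 : 0 < `|M| + 1 by rewrite ltr_wpDl.
have eM : 0 < e / (`|M| + 1) by rewrite divr_gt0.
move/cvgrPdist_lt : cz => /(_ _ eM) cz.
near=> i.
have hTi : forall x y, `|T i x - T i y| <= M * `|x - y| by near: i.
apply: (le_lt_trans (hTi _ _)).
apply: (@le_lt_trans _ _ ((`|M| + 1) * `|z i - z0|)).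
  by rewrite ler_wpM2r// (le_trans (ler_norm M))// lerDl.
by rewrite -ltr_pdivlMl// mulrC distrC; near: i.
Unshelve. all: by end_near. Qed.

Lemma bounded_op_cvg (U V : normedModType R) (T : U -> V) (I : Type) (F : set_system I)
    {FF : Filter F} (z : I -> U) (z0 : U) : bounded_op T ->
  z @ F --> z0 -> (fun i => T (z i)) @ F --> T z0.
Proof.
move=> bT cz; have [M M0 hM] := bounded_op_bound bT.
apply: (@cvg_lipschitz_family _ _ _ _ FF (fun=> T) z z0 _ M) => //; last exact: cvg_cst.
by apply: nearW => i x y; rewrite -bounded_op_linearB.
Qed.

(** Continuous orbits over a compact interval are bounded, so Banach-Steinhaus applies. The bound
    has the Lipschitz form that [cvg_lipschitz_family] takes. *)
Lemma uniform_bounded_family (U : completeNormedModType R) (V : normedModType R)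
    (a b : R) (T : R -> U -> V) :
  (forall u, a <= u <= b -> bounded_op (T u)) ->
  (forall x, {within `[a, b], continuous (fun u => T u x)}) ->
  exists M, forall u, a <= u <= b -> forall x y, `|T u x - T u y| <= M * `|x - y|.
Proof.
move=> bT cT.
pose F := [set T u | u in `[a, b]%classic].
have ubF : uniform_bounded F.
  apply: Banach_Steinhauss.
  - move=> _ [u + <-]; rewrite /= in_itv/= => /bT bTu; split; last exact: bTu.1.
    move=> r; have [M M0 hM] := bounded_op_bound bTu; exists (M * r) => x xr.
    by apply: (le_trans (hM x)); rewrite ler_pM2l.
  - move=> x; have /compact_bounded[M [_ hM]] :=
      continuous_compact (cT x) (@segment_compact _ a b).
    exists (M + 1) => _ [u uab <-].
    by apply: (hM (M + 1)); [rewrite ltrDl|exists u].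
have [M hM] := ubF 1; exists M => u uab x y.
have bTu := bT u uab; rewrite -bounded_op_linearB//; move: (x - y) => z.
have [->|z0] := eqVneq z 0; first by rewrite bounded_op0// !normr0 mulr0.
have nz0 : 0 < `|z| by rewrite normr_gt0.
rewrite -ler_pdivrMr//.
have -> : `|T u z| / `|z| = `|T u (`|z|^-1 *: z)|.
  by rewrite bounded_op_linearZ// normrZ ger0_norm ?invr_ge0// mulrC.
apply: hM; first by exists u => //=; rewrite in_itv.
by rewrite normrZ ger0_norm ?invr_ge0// mulVf// gt_eqF.
Qed.

End bounded_operators.

(** * Multiplication by a bounded measurable scalar function *)

Section bochner_scaling.
Context {R : realType} {Y : normedModType R}.
Notation mu := (@lebesgue_measure R).

Lemma simple_eval_le (l : seq (set R * Y)) x :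
  `|simple_eval l x| <= \sum_(p <- l) `|p.2|.
Proof.
rewrite /simple_eval; apply: (le_trans (ler_norm_sum _ _ _)); apply: ler_sum => p _.
by rewrite normrZ ler_piMl// indicE normr_nat; case: (x \in p.1).
Qed.

(** A simple function times [m] need not be simple, so the approximating sequence cannot just be
    scaled; the criterion for separable spaces is used instead. *)
Lemma bochner_integrableZ (D : set R) (m : R -> R) (M : R) (f : R -> Y) :
  separable Y -> measurable D -> (mu D < +oo)%E ->
  measurable_fun D m -> (forall x, D x -> `|m x| <= M) ->
  bochner_integrable D f -> bochner_integrable D (fun x => m x *: f x).
Proof.
move=> sepY mD Doo mm mM [sn /(bochner_approxP _ _ mD)[snok [N [mN N0 cv cvI]]]].
have mDN : measurable (D `\` N) by exact: measurableD.
have DNoo : (mu (D `\` N) < +oo)%E.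
  by apply: le_lt_trans Doo; apply: (le_measure mu); rewrite ?inE//; exact: subDsetl.
have mmDN : measurable_fun (D `\` N) m by apply: measurable_funS mm => //; exact: subDsetl.
have mmf y : measurable_fun (D `\` N) (fun x => `|m x *: f x - y|).
  apply: (measurable_fun_bochner_comp (k := fun x z => `|m x *: z - y|) (sn := sn)) => //.
  - move=> z; apply: (measurableT_comp (f := fun r : R => `|r *: z - y|)) => //.
    apply: continuous_measurable_fun => r; apply: cvg_norm; apply: cvgB; last exact: cvg_cst.
    exact: scalel_continuous.
  - move=> x Dx z; apply: cvg_norm; apply: cvgB; last exact: cvg_cst.
    exact: scaler_continuous.
apply: (@separable_bochner_integrable _ _ _ N) => //.
(* One approximation with [L1] error below [1] suffices: it is bounded by [K] on a set of finite
   measure, so the norm of [f] is integrable. *)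
have [n _ /(_ n (leqnn n)) hn] := cvg_lte_near ltr01 cvI.
have mfn : measurable_fun (D `\` N) (fun x => `|f x - simple_eval (sn n) x|).
  exact: (measurable_fun_norm_bochnerB (sn := sn)).
pose K := \sum_(p <- sn n) `|p.2|.
have K0 : 0 <= K by apply: sumr_ge0.
apply: (@le_lt_trans _ _ (\int[mu]_(x in D `\` N)
    (`|M|%:E * (`|f x - simple_eval (sn n) x|%:E + K%:E)))%E).
  apply: ge0_le_integral => //.
  - apply/measurable_EFinP; apply: eq_measurable_fun (mmf 0) => x _.
    by rewrite subr0.
  - apply: measurable_funeM; apply: emeasurable_funD; last exact: measurable_cst.
    exact/measurable_EFinP.
  - move=> x [Dx _]; rewrite -EFinD -EFinM lee_fin normrZ ler_pM//.
      by rewrite (le_trans (mM x Dx))// ler_norm.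
    rewrite -[X in `|X| <= _](subrK (simple_eval (sn n) x)).
    by rewrite (le_trans (ler_normD _ _))// lerD2l simple_eval_le.
rewrite ge0_integralZl//; last 2 first.
- by apply: emeasurable_funD; [exact/measurable_EFinP|exact: measurable_cst].
- by move=> x _; rewrite -EFinD lee_fin addr_ge0.
rewrite ge0_integralD//; last exact/measurable_EFinP.
rewrite integral_cst// lte_mul_pinfty//.
apply: lte_add_pinfty; first by apply: lt_trans hn _; rewrite ltry.
by rewrite lte_mul_pinfty.
Qed.

End bochner_scaling.

(** * First order expansion *)

Section time_domains.
Context {R : realType} (J : set R) (tdJ : time_domain J).

Lemma time_domain_ge0 x : J x -> 0 <= x.
Proof. by case: tdJ => [->|[T [_ ->]]] /=; rewrite in_itv/= => /andP[]. Qed.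

Lemma time_domain_convex x y z : J x -> J y -> x <= z <= y -> J z.
Proof.
move=> Jx Jy /andP[xz zy]; have := time_domain_ge0 Jx; move: Jx Jy.
case: tdJ => [->|[T [_ ->]]] /=; rewrite !in_itv/= => _.
- by move=> _ x0; rewrite (le_trans x0 xz).
- by move=> /andP[_ yT] x0; rewrite (le_trans x0 xz) (le_trans zy yT).
Qed.

Lemma time_domain_right_ok x y : J x -> J y -> x < y -> right_ok J x.
Proof.
move=> Jx Jy xy; rewrite /right_ok; near=> h.
apply: (time_domain_convex Jx Jy); apply/andP; split.
- by rewrite lerDl; near: h; exact: nbhs_right_ge.
- by rewrite -lerBrDl; near: h; apply: nbhs_right_le; rewrite subr_gt0.
Unshelve. all: by end_near. Qed.

Lemma cvg_within_at_right (V : normedModType R) (A : set R) (F : R -> V) (l : V) :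
  (\forall h \near 0^'+, A h) -> F @ within A 0^'+ --> l -> F @ 0^'+ --> l.
Proof.
by move=> hA cF P /cF FP; apply: filter_app hA; exact: FP.
Qed.

Lemma near_at_right_le (u v : R) : u < v -> \forall h \near 0^'+, 0 < h /\ u + h <= v.
Proof.
move=> uv; near=> h; split; first by near: h; exact: nbhs_right_gt.
by rewrite -lerBrDl; near: h; apply: nbhs_right_le; rewrite subr_gt0.
Unshelve. all: by end_near. Qed.

End time_domains.

(** * Orbits of the semigroup and integrability of the generator *)

Section semigroup.
Context {R : realType} {Y Y1 : completeNormedModType R} (iota : Y1 -> Y) (J : set R)
  (Gam : R -> R -> Y -> Y).
Context (emb : cont_embedding iota) (tdJ : time_domain J)
  (sg : inhom_semigroup J Gam) (reg : regular iota J Gam).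
Notation mu := (@lebesgue_measure R).
Notation leb := (@completed_lebesgue_measure R).
Local Notation A := (Agen J Gam).

Lemma gen_right_cvg u v f : J u -> J v -> u < v -> in_dom_gen J Gam u f ->
  h^-1 *: (Gam u (u + h) f - f) @[h --> 0^'+] --> A u f.
Proof.
move=> Ju Jv uv df.
have [_ [gr _]] : is_gen J Gam u f (A u f) by exact: xgetPex.
have rok := time_domain_right_ok tdJ Ju Jv uv.
exact: cvg_within_at_right (gr rok).
Qed.

(** By the semigroup law the increment is [Gam s u] applied to [Gam u (u + h) f - f], and the
    bounded operator [Gam s u] passes to the limit. The point [v] only witnesses that [J] continues
    to the right of [u]. *)
Lemma orbit_right_derivative s u v f : J s -> J u -> J v -> s <= u -> u < v ->
  in_dom_gen J Gam u f ->
  h^-1 *: (Gam s (u + h) f - Gam s u f) @[h --> 0^'+] --> Gam s u (A u f).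
Proof.
move=> Js Ju Jv su uv df.
have bsu : bounded_op (Gam s u) by exact: sg.1.
apply: cvg_trans (bounded_op_cvg bsu (gen_right_cvg Ju Jv uv df)).
apply: near_eq_cvg.
near=> h; have [h0 uhv] : 0 < h /\ u + h <= v by near: h; exact: near_at_right_le.
have uuh : u <= u + h by rewrite lerDl ltW.
have Juh : J (u + h) by apply: (time_domain_convex tdJ Ju Jv); rewrite uuh.
rewrite bounded_op_linearZ// bounded_op_linearB//.
by rewrite sg.2.2.
Unshelve. all: by end_near. Qed.

Lemma orbit_within_continuous s t f : J s -> J t ->
  {within `[s, t], continuous (fun u => Gam s u f)}.
Proof.
move=> Js Jt; have [_ [_ [_ [cG _]]]] := reg.
apply: continuous_subspaceW (cG f s Js) => u /=; rewrite in_itv/= => /andP[su ut].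
by split => //; apply: (time_domain_convex tdJ Js Jt); rewrite su.
Qed.

Lemma orbit_integral s t (f : Y1) : J s -> J t -> s <= t ->
  Gam s t (iota f) = iota f + bint `[s, t] (fun u => Gam s u (A u (iota f))).
Proof.
move=> Js Jt st; have [domf [_ [_ [_ int]]]] := reg.
rewrite (bochner_FTC (F := fun u => Gam s u (iota f)))//.
- by rewrite sg.2.1// addrC subrK.
- exact: orbit_within_continuous.
- move=> x /andP[sx xt].
  have Jx : J x by apply: (time_domain_convex tdJ Js Jt); rewrite sx ltW.
  exact: (orbit_right_derivative Js Jx Jt sx xt (domf f x Jx)).
- exact: int.
Qed.

Lemma orbit_integral_dom s u g : J s -> J u -> s <= u -> (exists g1, iota g1 = g) ->
  bint `[s, u] (fun r => Gam s r (A r g)) = Gam s u g - g.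
Proof. by move=> Js Ju su [g1 <-]; rewrite orbit_integral// addrC addKr. Qed.

(* The generator is the limit of difference quotients with increment
   [grid n u - u], and [grid n] is piecewise constant. *)
Let grid t n (u : R) : R := Num.min t ((Num.truncn (n.+1%:R * u)).+1%:R / n.+1%:R).

(** On a grid cell the second argument of [Gam] is frozen, and the quotient is continuous in the
    first one by the [Y1]-continuity in [regular]. The endpoint is removed because [grid t n t] does
    not exceed [t]. *)
Lemma generator_measurable s t (f : Y1) y : J s -> J t -> s <= t ->
  measurable_fun (`[s, t] `\` [set t]) (fun u => `|A u (iota f) - y|).
Proof.
move=> Js Jt st; have [domf [_ [cphi _]]] := reg.
have Jst u : s <= u <= t -> J u by exact: time_domain_convex.
have inD u : (`[s, t] `\` [set t]) u -> s <= u < t.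
  by move=> [/= + /eqP ut]; rewrite in_itv/= lt_neqAle ut => /andP[-> ->].
pose q n u := (grid t n u - u)^-1 *: (Gam u (grid t n u) (iota f) - iota f).
apply: (measurable_fun_cvg (h := fun n u => `|q n u - y|)); last first.
  move=> u /inD/andP[su ut].
  have Ju : J u by apply: Jst; rewrite su ltW.
  have u0 : 0 <= u by exact: time_domain_ge0 Ju.
  apply: cvg_norm; apply: cvgB; last exact: cvg_cst.
  have gu n : u < grid t n u.
    by rewrite /grid lt_min ut/= ltr_pdivlMr// mulrC truncnS_gt.
  have gu0 : grid t n u - u @[n --> \oo] --> (0 : R).
    apply: (squeeze_cvgr _ (cvg_cst 0) (@cvg_harmonic R)).
    apply: nearW => n; rewrite subr_ge0 ltW//= lerBlDr /grid ge_min; apply/orP; right.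
    rewrite ler_pdivrMr// mulrDl mulVf ?pnatr_eq0// -natr1 addrC lerD2l mulrC.
    by rewrite truncn_le mulr_ge0.
  have cr : grid t n u - u @[n --> \oo] --> (0 : R)^'+.
    move=> P /gu0; apply: (@filterS _ \oo) => n; apply.
    by rewrite /= subr_gt0.
  have := cvg_comp _ _ cr (gen_right_cvg Ju Jt ut (domf f u Ju)).
  by apply: cvg_trans; apply: near_eq_cvg; apply: nearW => n /=; rewrite /q subrKC.
move=> n.
(* The cells on which the truncation in [grid] equals [k]; they cover the interval because times in
   [J] are nonnegative. *)
pose E k := (`[s, t] `\` [set t]) `&` `[k%:R / n.+1%:R, k.+1%:R / n.+1%:R[%classic.
have mD : measurable (`[s, t] `\` [set t] : set R).
  by apply: measurableD => //; exact: measurable_itv.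
have mE k : measurable (E k) by apply: measurableI => //; exact: measurable_itv.
have -> : `[s, t] `\` [set t] = \bigcup_k E k.
  apply/seteqP; split=> [u Du|u [k _ []]//].
  have /andP[su ut] := inD u Du.
  have u0 : 0 <= u by apply: time_domain_ge0 tdJ _ _; apply: Jst; rewrite su ltW.
  exists (Num.truncn (n.+1%:R * u)) => //; split => //=.
  have /truncn_itv/andP[h1 h2] : 0 <= n.+1%:R * u by rewrite mulr_ge0.
  by rewrite in_itv/= ler_pdivrMr// ltr_pdivlMr// (mulrC u) h1.
apply/measurable_fun_bigcup => // k.
pose w := Num.min t (k.+1%:R / n.+1%:R).
apply: (@eq_measurable_fun _ _ _ _ (E k) (fun u : R => `|(w - u)^-1 *: (Gam u w (iota f) - iota f) - y|)).
  move=> u /set_mem[_]; rewrite /= in_itv/= => /andP[h1 h2].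
  rewrite /q /grid (_ : Num.truncn _ = k)//; apply: truncn_def.
  by rewrite mulrC -ler_pdivrMr// h1 -ltr_pdivlMr.
apply: subspace_continuous_measurable_fun => //.
apply/subspace_continuousP => u Eu.
have [/inD/andP[su ut]] := Eu; rewrite /= in_itv/= => /andP[_ uk].
have uw : u < w by rewrite /w lt_min ut.
have Jw : J w by apply: Jst; rewrite /w ge_min lexx (le_trans su (ltW uw)).
have Ju : J u by apply: Jst; rewrite su ltW.
apply: cvg_norm; apply: cvgB; last exact: cvg_cst.
have cw (V : normedModType R) (F : R -> V) (B : set R) : F @ within B (nbhs u) --> F u ->
    E k `<=` B -> F @ within (E k) (nbhs u) --> F u.
  by move=> cF EB; apply: cvg_trans cF; apply: cvg_app; exact: within_subset.
apply: cvgZ.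
  apply: cvgV; first by rewrite subr_eq0 gt_eqF.
  by apply: cvgB; [exact: cvg_cst|exact: cvg_within].
apply: cvgB; last exact: cvg_cst.
have [phi [phiE cph]] := cphi f w Jw.
have -> : Gam u w (iota f) = iota (phi u) by rewrite phiE// ltW.
have /(cw _ phi _) hphi : phi x @[x --> within [set u | J u /\ u <= w] (nbhs u)] --> phi u.
  by move/subspace_continuousP : cph; apply; split => //; exact: ltW.
have EB : E k `<=` [set v | J v /\ v <= w].
  move=> v [/inD/andP[sv vt]]; rewrite /= in_itv/= => /andP[_ vk].
  by split; [apply: Jst; rewrite sv ltW|rewrite /w le_min !ltW].
apply: cvg_trans (bounded_op_cvg emb.1 (hphi EB)); apply: near_eq_cvg.
rewrite near_withinE; apply: nearW => x /EB[Jx xw]; exact: phiE.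
Qed.

(** The norm of [A u (iota f)] is dominated by the operator norm times that of [f]. The domination
    takes place for the completed measure, where the operator norm is integrable, and is then
    carried back to [mu]. *)
Lemma generator_integrable s t (f : Y1) : separable Y -> J s -> J t -> s <= t ->
  (forall u, J u -> bounded_op (fun g : Y1 => A u (iota g))) ->
  leb.-integrable `[s, t] (fun u => (opnorm (fun g : Y1 => A u (iota g)))%:E) ->
  bochner_integrable `[s, t] (fun u => A u (iota f)).
Proof.
move=> sepY Js Jt st bA iA.
have mD : measurable `[s, t]%classic by exact: measurable_itv.
have mDt : measurable (`[s, t] `\` [set t]) by exact: measurableD.
have Jst u : s <= u <= t -> J u by exact: time_domain_convex.
have mAf := generator_measurable f 0 Js Jt st.
have mAf' : measurable_fun (`[s, t] `\` [set t]) (fun u => `|A u (iota f)|%:E).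
  by apply/measurable_EFinP; apply: eq_measurable_fun mAf => u _; rewrite subr0.
apply: (@separable_bochner_integrable _ _ _ [set t]) => //.
- by rewrite lebesgue_measure_itvcc// ltry.
- exact: lebesgue_measure_set1.
- by move=> y; exact: generator_measurable.
rewrite -ge0_integral_completed//.
have mDtT : measurable ((`[s, t] `\` [set t]) :
    set (caratheodory_type (@wlength R idfun)^*%mu)) by exact: sub_caratheodory.
have : leb.-integrable (`[s, t] `\` [set t]) (fun u => `|A u (iota f)|%:E).
  apply: (le_integrable mDtT (g := fun u => (`|f|%:E *
     (opnorm (fun g : Y1 => A u (iota g)))%:E)%E)).
  - exact: completed_measurable_fun.
  - move=> u [/= + _]; rewrite in_itv/= => /Jst Ju.
    rewrite /= normr_id lee_fin mulrC (le_trans _ (ler_norm _))//.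
    exact: (bounded_op_norm_le f (bA u Ju)).
  - apply: integrableZl => //; apply: integrableS iA => //.
    exact: sub_caratheodory.
move=> /integrableP[_]; congr (_ < _)%E; apply: eq_integral => u _ /=.
by rewrite normr_id.
Qed.

(** The orbit formula for [A u f] evaluates the inner integral as [Gam s u (A u f) - A u f], so
    adding the integral of [A u f] gives back the orbit formula for [f]. Integrability of the inner
    integral is recorded for the second expansion. *)
Lemma first_order_expansion s t f : separable Y -> J s -> J t -> s <= t ->
  (forall u, J u -> bounded_op (fun g : Y1 => A u (iota g))) ->
  leb.-integrable `[s, t] (fun u => (opnorm (fun g : Y1 => A u (iota g)))%:E) ->
  dom_AY1 iota J Gam f ->
  bochner_integrable `[s, t] (fun u => bint `[s, u] (fun r => Gam s r (A r (A u f)))) /\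
  Gam s t f = f + bint `[s, t] (fun u => A u f)
    + bint `[s, t] (fun u => bint `[s, u] (fun r => Gam s r (A r (A u f)))).
Proof.
move=> sepY Js Jt st bA iA [_ [[f1 <-] Af]].
have mD : measurable `[s, t]%classic by exact: measurable_itv.
have Doo : (mu `[s, t]%classic < +oo)%E by rewrite lebesgue_measure_itvcc// ltry.
have Jst u : s <= u <= t -> J u by exact: time_domain_convex.
have iAf := generator_integrable f1 sepY Js Jt st bA iA.
have iGA : bochner_integrable `[s, t] (fun u => Gam s u (A u (iota f1))).
  by have [_ [_ [_ [_ h]]]] := reg; exact: h.
have innerE u : `[s, t]%classic u ->
    bint `[s, u] (fun r => Gam s r (A r (A u (iota f1)))) =
    Gam s u (A u (iota f1)) + (-1) *: A u (iota f1).
  rewrite /= in_itv/= => /[dup] /andP[su _] /Jst Ju.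
  by rewrite (orbit_integral_dom Js Ju su (Af u Ju)) scaleN1r.
have iin : bochner_integrable `[s, t]
    (fun u => bint `[s, u] (fun r => Gam s r (A r (A u (iota f1))))).
  apply: (eq_bochner_integrable (fun u Du => esym (innerE u Du))).
  apply: (bochner_integrableD mD iGA).
  apply: (@bochner_integrableZ _ _ _ (cst (-1)) 1 _ sepY mD Doo _ _ iAf) => // u _.
  by rewrite normrN1.
split => //.
rewrite (orbit_integral f1 Js Jt st) -addrA; congr (_ + _).
rewrite -(bintD mD Doo iAf iin); apply: eq_bint => u Du.
by rewrite (innerE u Du) scaleN1r addrC subrK.
Qed.

End semigroup.

(** * Second order expansion *)

Lemma subr_rearrange (V : zmodType) (b c d e f : V) :
  b - c + ((d - b) - (e - f)) = d - e - (c - f).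
Proof. by rewrite addrA [b - c + _]addrC subrKA [RHS]subrACA. Qed.

(** The product rule for [(t - u) *: phi u] at the level of quotients, with [c = t - u],
    [x = phi (u + h)] and [z = phi u]. *)
Lemma scale_difference_quotient (K : fieldType) (V : lmodType K) (h c : K) (x z : V) :
  h != 0 -> h^-1 *: ((c - h) *: x - c *: z) = c *: (h^-1 *: (x - z)) - x.
Proof.
move=> h0; rewrite scalerBl addrAC -scalerBr [LHS]scalerBr !scalerA mulVf// scale1r.
by rewrite mulrC.
Qed.

Section second_order.
Context {R : realType} {Y Y1 : completeNormedModType R} (iota : Y1 -> Y) (J : set R)
  (Gam : R -> R -> Y -> Y).
Context (emb : cont_embedding iota) (tdJ : time_domain J)
  (sg : inhom_semigroup J Gam) (reg : regular iota J Gam).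
Notation mu := (@lebesgue_measure R).
Notation leb := (@completed_lebesgue_measure R).
Local Notation A := (Agen J Gam).
Local Notation A' := (Aprime iota J Gam).

Lemma near_dist_lt (u r : R) : 0 < r -> \forall x \near u, `|u - x| < r.
Proof. by move=> r0; apply/nbhs_ballP; exists r => //= z; rewrite -ball_normE. Qed.

Lemma preimK y : (exists x, iota x = y) -> iota (Defs.preim iota y) = y.
Proof. by move=> ex; exact: (xgetPex 0 ex). Qed.

Lemma within_itv_cvg_at_right (V : normedModType R) (G : R -> V) (s t u : R) :
  {within `[s, t], continuous G} -> s <= u < t -> G (u + h) @[h --> 0^'+] --> G u.
Proof.
move=> cG /andP[su ut]; apply/cvgrPdist_lt => e e0.
have [|r r0 hr] := within_itv_continuous_dist (c := u) cG _ e0; first by rewrite su ltW.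
near=> h; have [h0 uht] : 0 < h /\ u + h <= t by near: h; exact: near_at_right_le.
have hr0 : h < r by near: h; exact: nbhs_right_lt.
apply: hr; first by rewrite uht (le_trans su)// lerDl ltW.
by rewrite opprD addNKr normrN gtr0_norm.
Unshelve. all: by end_near. Qed.

Lemma Aprime_right_derivative u v f d : J u -> J v -> u < v ->
  is_Aprime iota J Gam u f d ->
  h^-1 *: (Defs.preim iota (A (u + h) f) - Defs.preim iota (A u f)) @[h --> 0^'+] --> d.
Proof.
move=> Ju Jv uv dd P /dd hP.
have rok : nbhs (0 : R) [set h | 0 < h -> J (u + h)].
  exact: time_domain_right_ok Ju Jv uv.
apply: (@filterS2 _ (nbhs (0 : R)) _ _ _ _ _ rok hP) => h Jh Ph h0.
by apply: Ph; [exact: lt0r_neq0|exact: Jh].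
Qed.

(** Close to [u] the difference quotient is within [1] of [d], which gives the constant
    [|d| + 1]. *)
Lemma Aprime_lipschitz u f d : is_Aprime iota J Gam u f d ->
  exists K r : R, 0 < r /\ forall x, J x -> `|x - u| < r ->
    `|Defs.preim iota (A x f) - Defs.preim iota (A u f)| <= K * `|x - u|.
Proof.
move=> /cvgrPdist_lt/(_ 1 ltr01) /nbhs_ballP[r /= r0 hr].
exists (`|d| + 1), r; split => // x Jx xr.
have [->|xu] := eqVneq x u; first by rewrite !subrr !normr0 mulr0.
have xu0 : x - u != 0 by rewrite subr_eq0.
have := hr (x - u); rewrite -ball_normE /= sub0r normrN => /(_ xr xu0).
rewrite subrKC => /(_ Jx) /ltW h.
rewrite mulrC -ler_pdivrMl ?normr_gt0//.
rewrite -normfV -normrZ -lerBlDl; apply: le_trans h.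
by rewrite distrC lerB_dist.
Qed.

Section expansion.
Context (s t : R) (f : Y) (Js : J s) (Jt : J t) (st : s <= t)
  (dom : dom_Aprime iota J Gam f).
(** [A u f] seen in [Y1], in whose norm the derivative [A'] is taken. *)
Let a u : Y1 := Defs.preim iota (A u f).

Let Jst u : s <= u <= t -> J u.
Proof. exact: time_domain_convex. Qed.

Let aE u : J u -> iota (a u) = A u f.
Proof. by move=> Ju; apply: preimK; have [[_ [_ h]] _] := dom; exact: h. Qed.

Let derA u : J u -> is_Aprime iota J Gam u f (A' u f).
Proof. by move=> Ju; have [_ h] := dom; exact: (xgetPex 0 (h u Ju)). Qed.

Lemma generator_orbit_within_continuous :
  {within `[s, t], continuous (fun u => iota (a u))}.
Proof.
apply/subspace_continuousP => u /=; rewrite in_itv/= => /Jst Ju.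
apply: bounded_op_cvg emb.1 _.
have [K [r [r0 hK]]] := Aprime_lipschitz (derA Ju).
apply/cvgrPdist_lt => e e0.
have K0 : 0 < `|K| + 1 by rewrite ltr_wpDl.
have eK : 0 < e / (`|K| + 1) by rewrite divr_gt0.
rewrite near_withinE; near=> x => /=; rewrite in_itv/= => /Jst Jx.
have xr : `|x - u| < r by rewrite distrC; near: x; exact: near_dist_lt.
rewrite distrC; apply: (le_lt_trans (hK x Jx xr)).
apply: (@le_lt_trans _ _ ((`|K| + 1) * `|x - u|)).
  by rewrite ler_wpM2r// (le_trans (ler_norm K))// lerDl.
by rewrite -ltr_pdivlMl// mulrC distrC; near: x; exact: near_dist_lt.
Unshelve. all: by end_near. Qed.

Let phi u := Gam s u (iota (a u)) - iota (a u).

Let lipG : exists M, forall u, s <= u <= t ->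
  forall x y, `|Gam s u x - Gam s u y| <= M * `|x - y|.
Proof.
apply: uniform_bounded_family => [u /[dup] /andP[su _] /Jst Ju|x].
- exact: sg.1.
- exact: (orbit_within_continuous tdJ reg).
Qed.

Lemma remainder_within_continuous : {within `[s, t], continuous phi}.
Proof.
have [M hM] := lipG.
apply/subspace_continuousP => u uD.
have ca : iota (a x) @[x --> within `[s, t]%classic (nbhs u)] --> iota (a u).
  by move/subspace_continuousP : generator_orbit_within_continuous; apply.
apply: cvgB => //.
apply: (@cvg_lipschitz_family _ _ _ _ _ _ (fun x => Gam s x) (fun x => iota (a x))
  (iota (a u)) _ M) => //.
- by rewrite near_withinE; apply: nearW => x /=; rewrite in_itv/=; exact: hM.
- have /subspace_continuousP h := orbit_within_continuous tdJ reg (f := iota (a u)) Js Jt.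
  exact: h.
Qed.

Lemma remainder_right_derivative u : s <= u < t ->
  h^-1 *: (phi (u + h) - phi u) @[h --> 0^'+] -->
    Gam s u (A u (A u f)) + (Gam s u (iota (A' u f)) - iota (A' u f)).
Proof.
move=> /[dup] sut /andP[su ut].
have Ju : J u by apply: Jst; rewrite su ltW.
have [domY1 _] := reg.
have [M hM] := lipG.
have c0 : iota (h^-1 *: (a (u + h) - a u)) @[h --> 0^'+] --> iota (A' u f).
  exact: (bounded_op_cvg emb.1 (Aprime_right_derivative Ju Jt ut (derA Ju))).
have c1 : Gam s (u + h) (iota (h^-1 *: (a (u + h) - a u))) @[h --> 0^'+] -->
    Gam s u (iota (A' u f)).
  apply: (@cvg_lipschitz_family _ _ _ _ _ _ (fun h => Gam s (u + h))
    (fun h => iota (h^-1 *: (a (u + h) - a u))) (iota (A' u f)) _ M); last 2 first.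
  - exact: c0.
  - exact: (within_itv_cvg_at_right
      (orbit_within_continuous tdJ reg (f := iota (A' u f)) Js Jt)).
  - near=> h; have [h0 uht] : 0 < h /\ u + h <= t by near: h; exact: near_at_right_le.
    by apply: hM; rewrite uht (le_trans su)// lerDl ltW.
have c2 : h^-1 *: (Gam s (u + h) (iota (a u)) - Gam s u (iota (a u))) @[h --> 0^'+] -->
    Gam s u (A u (A u f)).
  have -> : A u (A u f) = A u (iota (a u)) by rewrite aE.
  exact: (orbit_right_derivative tdJ sg Js Ju Jt su ut (domY1 _ _ Ju)).
(* The quotient of [phi] splits into the increment of the operator at the fixed vector [a u], and
   [Gam s (u + h)] minus the identity applied to the quotient of [a]. *)
have c3 : h^-1 *: (Gam s (u + h) (iota (a u)) - Gam s u (iota (a u))) +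
    (Gam s (u + h) (iota (h^-1 *: (a (u + h) - a u))) - iota (h^-1 *: (a (u + h) - a u)))
    @[h --> 0^'+] --> Gam s u (A u (A u f)) + (Gam s u (iota (A' u f)) - iota (A' u f)).
  by apply: cvgD; [exact: c2|apply: cvgB; [exact: c1|exact: c0]].
apply: cvg_trans c3; apply: near_eq_cvg.
near=> h; have [h0 uht] : 0 < h /\ u + h <= t by near: h; exact: near_at_right_le.
have suh : s <= u + h by rewrite (le_trans su)// lerDl ltW.
have Juh : J (u + h) by apply: Jst; rewrite suh.
have bG : bounded_op (Gam s (u + h)) by exact: sg.1.
have iB k x y : iota (k *: (x - y)) = k *: (iota x - iota y).
  by have bi := emb.1; rewrite bounded_op_linearZ// bounded_op_linearB.
rewrite /= !iB (bounded_op_linearZ _ _ bG) (bounded_op_linearB _ _ bG).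
rewrite -scalerBr -scalerDr; congr (_ *: _); exact: subr_rearrange.
Unshelve. all: by end_near. Qed.

(** Integration by parts for the integral of [phi], with [t - u] as primitive of [-1]. *)
Lemma remainder_integral : separable Y ->
  bochner_integrable `[s, t] (fun u => bint `[s, u] (fun r => Gam s r (A r (A u f)))) ->
  bochner_integrable `[s, t] (fun u => Gam s u (A u (A u f))) ->
  bochner_integrable `[s, t]
    (fun u => bint `[s, u] (fun r => Gam s r (A r (iota (A' u f))))) ->
  bint `[s, t] (fun u => bint `[s, u] (fun r => Gam s r (A r (A u f)))) =
  bint `[s, t] (fun u => (t - u) *: Gam s u (A u (A u f))) +
  bint `[s, t] (fun u => (t - u) *:
    bint `[s, u] (fun r => Gam s r (A r (iota (A' u f))))).
Proof.
move=> sepY iq iP iQ.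
have mD : measurable `[s, t]%classic by exact: measurable_itv.
have Doo : (mu `[s, t]%classic < +oo)%E by rewrite lebesgue_measure_itvcc// ltry.
set q := fun u => bint `[s, u] (fun r => Gam s r (A r (A u f))) in iq *.
set P := fun u => Gam s u (A u (A u f)) in iP *.
set Q := fun u => bint `[s, u] (fun r => Gam s r (A r (iota (A' u f)))) in iQ *.
have qE u : s <= u <= t -> q u = phi u.
  move=> /[dup] /andP[su _] /Jst Ju.
  by rewrite /q /phi aE// (orbit_integral_dom tdJ sg reg)//; exists (a u); exact: aE.
have QE u : s <= u <= t -> Q u = Gam s u (iota (A' u f)) - iota (A' u f).
  move=> /[dup] /andP[su _] /Jst Ju.
  by rewrite /Q (orbit_integral_dom tdJ sg reg)//; exists (A' u f).
have scale_int (F : R -> Y) : bochner_integrable `[s, t] F ->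
    bochner_integrable `[s, t] (fun u => (t - u) *: F u).
  apply: (@bochner_integrableZ _ _ _ (fun u => t - u) (t - s)) => //.
    exact: measurable_funB.
  move=> u /=; rewrite in_itv/= => /andP[su ut].
  by rewrite ger0_norm ?subr_ge0// lerB.
have imP := scale_int _ iP; have imQ := scale_int _ iQ.
(* This integrand is the right derivative of [(t - u) *: phi u], because [q] agrees with [phi] and
   [P + Q] is the right derivative of [phi]. *)
have ig : bochner_integrable `[s, t] (fun u => ((t - u) *: P u + (t - u) *: Q u) + (-1) *: q u).
  apply: (bochner_integrableD mD (bochner_integrableD mD imP imQ)).
  apply: (@bochner_integrableZ _ _ _ (cst (-1)) 1 _ sepY mD Doo _ _ iq) => // u _.
  by rewrite normrN1.
have FTC : bint `[s, t] (fun u => ((t - u) *: P u + (t - u) *: Q u) + (-1) *: q u) =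
    (t - t) *: phi t - (t - s) *: phi s.
  apply: (bochner_FTC (F := fun u => (t - u) *: phi u) st _ _ ig).
  - apply/subspace_continuousP => u uD; apply: cvgZ.
      by apply: cvgB; [exact: cvg_cst|exact: cvg_within].
    by move/subspace_continuousP : remainder_within_continuous; apply.
  - move=> u /[dup] sut /andP[su ut].
    have sut' : s <= u <= t by rewrite su ltW.
    have c1 := remainder_right_derivative sut.
    have c2 := within_itv_cvg_at_right remainder_within_continuous sut.
    have -> : (t - u) *: P u + (t - u) *: Q u + (-1) *: q u =
        (t - u) *: (P u + Q u) - phi u.
      by rewrite scalerDr scaleN1r qE.
    rewrite QE//.
    have c3 : (t - u) *: (h^-1 *: (phi (u + h) - phi u)) - phi (u + h) @[h --> 0^'+] -->
        (t - u) *: (P u + (Gam s u (iota (A' u f)) - iota (A' u f))) - phi u.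
      by apply: cvgB; [apply: cvgZl_tmp; exact: c1|exact: c2].
    apply: cvg_trans c3; apply: near_eq_cvg.
    near=> h; have [h0 _] : 0 < h /\ u + h <= t by near: h; exact: near_at_right_le.
    have -> : t - (u + h) = t - u - h by rewrite opprD addrA.
    exact/esym/scale_difference_quotient/lt0r_neq0.
(* The second integral is [0] since [t - t = 0] and [phi s = 0]; adding it to that of [q] cancels
   [q] and leaves the weighted terms. *)
have := bintD mD Doo iq ig; rewrite FTC subrr scale0r sub0r.
have -> : phi s = 0 by rewrite /phi sg.2.1// subrr.
rewrite scaler0 oppr0 addr0 => <-.
rewrite -(bintD mD Doo imP imQ); apply: eq_bint => u _.
by rewrite scaleN1r addrC subrK.
Unshelve. all: by end_near. Qed.

End expansion.
End second_order.

Unset Implicit Arguments.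

Theorem theorem2p13 (R : realType) (Y Y1 : completeNormedModType R)
  (iota : Y1 -> Y) (J : set R) (Gam : R -> R -> Y -> Y) (s t : R) :
  separable Y -> separable Y1 -> cont_embedding iota ->
  time_domain J -> inhom_semigroup J Gam -> regular iota J Gam ->
  J s -> J t -> s <= t ->
  (forall u, J u -> bounded_op (fun g : Y1 => Agen J Gam u (iota g))) ->
  (@completed_lebesgue_measure R).-integrable `[s, t]
     (fun u => (opnorm (fun g : Y1 => Agen J Gam u (iota g)))%:E) ->
  (forall f : Y, dom_AY1 iota J Gam f ->
     Gam s t f =
       f + bint `[s, t] (fun u => Agen J Gam u f)
         + bint `[s, t] (fun u =>
             bint `[s, u] (fun r => Gam s r (Agen J Gam r (Agen J Gam u f)))))
  /\
  (Y1_strongly_continuous iota J Gam ->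
   forall f : Y, dom_Aprime iota J Gam f ->
     bochner_integrable `[s, t]
       (fun u => Gam s u (Agen J Gam u (Agen J Gam u f))) ->
     bochner_integrable `[s, t]
       (fun u => bint `[s, u]
          (fun r => Gam s r (Agen J Gam r (iota (Aprime iota J Gam u f))))) ->
     Gam s t f =
       f + bint `[s, t] (fun u => Agen J Gam u f)
         + bint `[s, t] (fun u => (t - u) *: Gam s u (Agen J Gam u (Agen J Gam u f)))
         + bint `[s, t] (fun u => (t - u) *:
             bint `[s, u]
               (fun r => Gam s r (Agen J Gam r (iota (Aprime iota J Gam u f)))))).
Proof.
move=> sepY _ emb tdJ sg reg Js Jt st bA iA; split=> [f df|_ f df iP iQ].
  by have [] := first_order_expansion emb tdJ sg reg sepY Js Jt st bA iA df.
have [iq ->] := first_order_expansion emb tdJ sg reg sepY Js Jt st bA iA df.1.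
by rewrite (remainder_integral emb tdJ sg reg Js Jt st df sepY iq iP iQ) addrA.
Qed.
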